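(* Let $G$ be a discrete group containing an infinite Abelian subgroup. Then there exists $f\in \mathrm{B}_{0}(G)$ with a non-natural spectrum, i.e. with $\sigma(f)\neq\overline{f(G)}$. In particular, $G$ (identified with the set of point evaluations) is not dense in the Gelfand space $\triangle(\mathrm{B}_{0}(G))$.
   Context: For a discrete group $G$, $\mathrm{B}(G)$ is the Fourier--Stieltjes algebra: the linear span of positive definite functions on $G$, a commutative unital Banach algebra under pointwise multiplication with the norm of $\mathrm{B}(G)=C^{\ast}(G)^{\ast}$ (dual of the full group $C^*$-algebra). $\mathrm{B}_{0}(G):=\mathrm{B}(G)\cap c_{0}(G)$ is a closed ideal of $\mathrm{B}(G)$. $\sigma(f)$ is the spectrum of $f$ in $\mathrm{B}(G)$; $f$ has a natural spectrum if $\sigma(f)=\overline{f(G)}$. For a commutative Banach algebra $A$, $\triangle(A)$ is the set of (nonzero) multiplicative linear functionals on $A$ with the weak$^*$ topology. *)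

(* Defs.v *)
From HB Require Import structures.
From mathcomp Require Import all_boot all_order all_algebra.
From mathcomp Require Import complex.
From mathcomp Require Import all_classical all_reals.
From mathcomp Require Import topology normedtype.
From mathcomp Require Import ring.

Set Implicit Arguments.
Unset Strict Implicit.
Unset Printing Implicit Defensive.

Import Order.TTheory GRing.Theory Num.Theory.
Import numFieldNormedType.Exports.

Local Open Scope classical_set_scope.
Local Open Scope ring_scope.
Local Open Scope sesquilinear_scope.

(* [R[i]] seen only as a [numClosedFieldType]: this selects its usual topology
   and its structure of module over itself (rather than over [R]). *)
Definition Cx (R : realType) : numClosedFieldType := R[i]%C.

Definition spectrum (K : fieldType) (A : algType K) (a : A) : set K :=
  [set l | ~ exists b : A, b * (a - l%:A) = 1 /\ (a - l%:A) * b = 1].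

(* Characters of a possibly non-unital algebra, given as a module [A] with a
   product [mul]. The type [{ptws A -> K}] carries the topology of pointwise
   convergence, which induces the weak* topology. Characters of a commutative
   Banach algebra are automatically continuous, so no norm is involved. *)
Definition gelfand_space (K : numFieldType) (A : lmodType K)
    (mul : A -> A -> A) : set {ptws A -> K} :=
  [set chi | [/\ scalar (chi : A -> K),
                 forall f g, chi (mul f g) = chi f * chi g
               & exists f, chi f != 0]].

Definition has_infinite_abelian_subgroup (G : groupType) : Prop :=
  exists H : {pred G},
    [/\ group_closed H, {in H &, forall x y, commute x y}
      & infinite_set [set` H]].

Section PositiveSemidefinite.
Variables (C : numClosedFieldType) (n : nat) (M : 'M[C]_n).
Hypothesis psdM : forall c : 'rV[C]_n, 0 <= (c *m M *m c^t*) 0 0.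

Lemma psd_hermitian i j : M j i = (M i j)^*.
Proof.
have Q z : M i i + z^* * M i j + z * M j i + z * z^* * M j j \is Num.real.
  have /ger0_real := psdM (delta_mx 0 i + z *: delta_mx 0 j).
  have -> : (delta_mx 0 i + z *: delta_mx 0 j : 'rV[C]_n) ^t* =
      delta_mx i 0 + z^* *: delta_mx j 0.
    by apply/matrixP => k l; rewrite !mxE rmorphD rmorphM !rmorph_nat andbC [X in z^* * (nat_of_bool X)%:R]andbC.
  rewrite !mulmxDl !mulmxDr -!scalemxAl -!scalemxAr.
  rewrite -!mulmxA -!colE -!rowE !mxE.
  by rewrite mulrA addrA.
have Rii k : M k k \is Num.real.
  have /ger0_real := psdM (delta_mx 0 k).
  by rewrite trmx_delta map_delta_mx -mulmxA -colE -rowE !mxE.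
have R1 : M i j + M j i \is Num.real.
  have -> : M i j + M j i = (M i i + 1^* * M i j + 1 * M j i + 1 * 1^* * M j j)
    - M i i - M j j by rewrite rmorph1; ring.
  by rewrite !rpredB.
have R2 : 'i * (M j i - M i j) \is Num.real.
  have -> : 'i * (M j i - M i j) =
    (M i i + 'i^* * M i j + 'i * M j i + 'i * 'i^* * M j j) - M i i - M j j.
    by rewrite -normCK normCi conjCi; ring.
  by rewrite !rpredB.
move: R1 R2 => /CrealP; rewrite rmorphD /= => E1 /CrealP.
rewrite rmorphM rmorphB /= conjCi mulNr -mulrN opprB.
move=> /(mulfI (neq0Ci _)) E2.
have : 2%:R * (M i j)^* = 2%:R * M j i.
  have -> : 2%:R * (M i j)^* = ((M i j)^* + (M j i)^*) + ((M i j)^* - (M j i)^*).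
    by ring.
  by rewrite E1 E2; ring.
by move/mulfI => -> //; rewrite pnatr_eq0.
Qed.

Lemma psd_factor : exists u : 'M[C]_n,
  forall i j, M i j = \sum_k u k i * (u k j)^*.
Proof.
have herm : M \is hermsymmx.
  apply/is_hermitianmxP; rewrite expr0 scale1r.
  by apply/matrixP => i j; rewrite !mxE psd_hermitian.
have /hermitian_normalmx/orthomx_spectralP := herm.
set P := spectralmx M; set d := spectral_diag M => E.
have uP : P \is unitarymx by exact: spectral_unitarymx.
have dE k : d 0 k = (row k P *m M *m (row k P)^t*) 0 0.
  have -> : (row k P *m M *m (row k P)^t*) 0 0 = (P *m M *m P^t*) k k.
    rewrite -row_mul !mxE;
    by apply: eq_bigr => l _; rewrite !mxE.
  have PP : P *m P^t* = 1%:M by apply/unitarymxP.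
  have -> : P *m M *m P^t* = diag_mx d.
    by rewrite E invmx_unitary // !mulmxA PP mul1mx -mulmxA PP mulmx1.
  by rewrite !mxE eqxx.
have d_ge0 k : 0 <= d 0 k by rewrite dE psdM.
exists (\matrix_(k, i) (sqrtC (d 0 k) * (P k i)^*)) => i j.
rewrite {1}E invmx_unitary // mul_mx_diag !mxE; apply: eq_bigr => k _.
rewrite !mxE rmorphM /= conjCK.
have -> : (sqrtC (d 0 k))^* = sqrtC (d 0 k).
  by apply/CrealP/ger0_real; rewrite sqrtC_ge0.
have -> : sqrtC (d 0 k) * (P k i)^* * (sqrtC (d 0 k) * P k j) = 
  sqrtC (d 0 k) ^+ 2 * (P k i)^* * P k j by ring.
by rewrite sqrtCK; ring.
Qed.

End PositiveSemidefinite.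

Section PositiveDefinite.
Variables (R : realType) (G : groupType).
Local Notation C := (Cx R).
Implicit Types (f phi psi : G -> C).

(* [0 <= z] in [C] says that [z] is real and nonnegative. *)
Definition posdef phi : Prop :=
  forall (n : nat) (g : 'I_n -> G) (c : 'I_n -> C),
    0 <= \sum_(i < n) \sum_(j < n) c i * (c j)^* * phi ((g j)^-1 * g i)%g.

Definition fourier_stieltjes : set (G -> C) :=
  [set f | exists (n : nat) (a : 'I_n -> C) (phi : 'I_n -> G -> C),
     (forall k, posdef (phi k)) /\ f = \sum_(k < n) a k *: phi k].

Definition vanishes_at_infinity f : Prop :=
  forall e : C, 0 < e -> finite_set [set x | e <= `|f x|].

Lemma posdef1 : posdef 1.
Proof.
move=> n g c.
under eq_bigr do under eq_bigr do rewrite mulr1.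
under eq_bigr do rewrite -mulr_sumr.
by rewrite -mulr_suml -rmorph_sum -normCK exprn_ge0.
Qed.

Lemma posdefM phi psi : posdef phi -> posdef psi -> posdef (phi * psi).
Proof.
move=> pphi ppsi n g c.
pose M : 'M[C]_n := \matrix_(i, j) phi ((g j)^-1 * g i)%g.
have [|u uE] := @psd_factor C n M.
  move=> d; have := pphi n g (d 0); congr (0 <= _).
  rewrite -mulmxA !mxE; apply: eq_bigr => i _.
  rewrite !mxE mulr_sumr; apply: eq_bigr => j _.
  by rewrite !mxE mulrA mulrAC.
have -> : \sum_(i < n) \sum_(j < n)
      c i * (c j)^* * (phi * psi) ((g j)^-1 * g i)%g =
    \sum_(k < n) \sum_(i < n) \sum_(j < n)
      (c i * u k i) * (c j * u k j)^* * psi ((g j)^-1 * g i)%g.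
  rewrite [RHS]exchange_big /=; apply: eq_bigr => i _.
  rewrite [RHS]exchange_big /=; apply: eq_bigr => j _.
  transitivity (c i * (c j)^* * (M i j * psi ((g j)^-1 * g i)%g)).
    by rewrite mxE.
  rewrite uE mulr_suml mulr_sumr; apply: eq_bigr => k _.
  by rewrite rmorphM /=; ring.
by apply: sumr_ge0 => k _; exact: (ppsi n g (fun i => c i * u k i)).
Qed.

Lemma fourier_stieltjes_posdef phi : posdef phi -> fourier_stieltjes phi.
Proof.
move=> pphi; exists 1, (fun=> 1), (fun=> phi); split=> //.
by rewrite big_ord1 scale1r.
Qed.

Lemma fourier_stieltjesD f1 f2 : fourier_stieltjes f1 ->
  fourier_stieltjes f2 -> fourier_stieltjes (f1 + f2).
Proof.
move=> [m [a [phi [pphi ->]]]] [n [b [psi [ppsi ->]]]].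
exists (m + n)%N,
  (fun k => match fintype.split k with inl i => a i | inr j => b j end),
  (fun k => match fintype.split k with inl i => phi i | inr j => psi j end).
split=> [k|]; first by case: (fintype.split k).
rewrite big_split_ord /=; congr (_ + _); apply: eq_bigr => k _.
  by rewrite -[lshift n k]/(unsplit (inl k)) unsplitK.
by rewrite -[rshift m k]/(unsplit (inr k)) unsplitK.
Qed.

Lemma fourier_stieltjesZ (a : C) f :
  fourier_stieltjes f -> fourier_stieltjes (a *: f).
Proof.
move=> [n [b [phi [pphi ->]]]]; exists n, (fun k => a * b k), phi; split=> //.
by rewrite scaler_sumr; apply: eq_bigr => k _; rewrite scalerA.
Qed.

Lemma fourier_stieltjes0 : fourier_stieltjes 0.
Proof.
by exists 0, (fun=> 0), (fun=> 0); split=> [[]//|]; rewrite big_ord0.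
Qed.

Lemma fourier_stieltjes_sum n (F : 'I_n -> G -> C) :
  (forall k, fourier_stieltjes (F k)) -> fourier_stieltjes (\sum_k F k).
Proof.
move=> fsF; apply: big_ind => //; first exact: fourier_stieltjes0.
exact: fourier_stieltjesD.
Qed.

Lemma fourier_stieltjesM f1 f2 : fourier_stieltjes f1 ->
  fourier_stieltjes f2 -> fourier_stieltjes (f1 * f2).
Proof.
move=> [m [a [phi [pphi ->]]]] [n [b [psi [ppsi ->]]]].
rewrite mulr_suml; apply: fourier_stieltjes_sum => i.
rewrite mulr_sumr; apply: fourier_stieltjes_sum => j.
have -> : (a i *: phi i) * (b j *: psi j) = (a i * b j) *: (phi i * psi j).
  apply/funext => x.
  change (a i * phi i x * (b j * psi j x) = a i * b j * (phi i x * psi j x)).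
  by ring.
by apply/fourier_stieltjesZ/fourier_stieltjes_posdef/posdefM.
Qed.

Lemma vanishes_at_infinity0 : vanishes_at_infinity 0.
Proof.
move=> e e0; apply: (sub_finite_set _ (finite_set0 _)) => x /=.
by rewrite normr0 => /(lt_le_trans e0); rewrite ltxx.
Qed.

Lemma vanishes_at_infinityD f1 f2 : vanishes_at_infinity f1 ->
  vanishes_at_infinity f2 -> vanishes_at_infinity (f1 + f2).
Proof.
move=> f10 f20 e e0.
have e20 : 0 < e / 2 by rewrite divr_gt0.
have fin : finite_set ([set x | e / 2 <= `|f1 x|] `|` [set x | e / 2 <= `|f2 x|]).
  by rewrite finite_setU; split; [exact: f10|exact: f20].
apply: (sub_finite_set _ fin) => x /= ex.
case: (real_leP (ger0_real (ltW e20)) (normr_real (f1 x))); first by left.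
move=> lt1; right; have lt2 := le_trans ex (ler_normD _ _).
rewrite -(lerD2l `|f1 x|); apply: le_trans lt2.
by rewrite [leRHS]splitr lerD2r ltW.
Qed.

Lemma vanishes_at_infinityM f1 f2 : vanishes_at_infinity f1 ->
  vanishes_at_infinity f2 -> vanishes_at_infinity (f1 * f2).
Proof.
move=> f10 f20 e e0.
have fin : finite_set ([set x | e <= `|f1 x|] `|` [set x | 1 <= `|f2 x|]).
  by rewrite finite_setU; split; [exact: f10|exact: f20].
apply: (sub_finite_set _ fin) => x /=.
rewrite -[(f1 * f2) x]/(f1 x * f2 x) normrM => ex.
case: (real_leP (ger0_real (ltW e0)) (normr_real (f1 x))); first by left.
move=> lt1; right; rewrite real_leNgt ?normr_real ?real1 //.
apply/negP => lt2; suff : e < e by rewrite ltxx.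
apply: le_lt_trans ex _; apply: le_lt_trans lt1.
by rewrite ler_piMr // ltW.
Qed.

Lemma vanishes_at_infinityZ (a : C) f :
  vanishes_at_infinity f -> vanishes_at_infinity (a *: f).
Proof.
move=> f0 e e0; have a1 : 0 < `|a| + 1 by rewrite ltr_wpDl.
apply: (sub_finite_set _ (f0 (e / (`|a| + 1)) _)); last by rewrite divr_gt0.
move=> x /=; rewrite -[(a *: f) x]/(a * f x) normrM => ex.
rewrite ler_pdivrMr // mulrC; apply: le_trans ex _.
by rewrite ler_wpM2r // lerDl.
Qed.

End PositiveDefinite.

Arguments fourier_stieltjes : clear implicits.

Section FourierStieltjesAlgebra.
Variables (R : realType) (G : groupType).
Local Notation C := (Cx R).

(* B(G) *)
Definition fsalg : Type := {f : G -> C | f \in fourier_stieltjes R G}.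

HB.instance Definition _ := SubChoice.on fsalg.

Lemma fourier_stieltjes_subring_closed :
  subring_closed [in fourier_stieltjes R G].
Proof.
split=> [|f1 f2|f1 f2]; rewrite !inE /=.
- exact/fourier_stieltjes_posdef/posdef1.
- by move=> ? ?; rewrite -scaleN1r;
    apply/fourier_stieltjesD => //; exact: fourier_stieltjesZ.
- exact: fourier_stieltjesM.
Qed.

Lemma fourier_stieltjes_subsemimod_closed :
  subsemimod_closed [in fourier_stieltjes R G].
Proof.
split; first split=> [|f1 f2]; rewrite ?inE //=.
- exact: fourier_stieltjes0.
- exact: fourier_stieltjesD.
- by move=> a f; rewrite !inE; exact: fourier_stieltjesZ.
Qed.

HB.instance Definition _ := GRing.SubChoice_isSubComPzRing.Build
  (G -> C) [in fourier_stieltjes R G] fsalg fourier_stieltjes_subring_closed.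

HB.instance Definition _ := GRing.SubZmodule_isSubLmodule.Build
  C (G -> C) [in fourier_stieltjes R G] fsalg
  fourier_stieltjes_subsemimod_closed.

Lemma fsalg_oner_neq0 : (1 : fsalg) != 0.
Proof.
apply/eqP => /(congr1 val)/(congr1 (fun f : G -> C => f 1%g)) /=.
by apply/eqP/oner_neq0.
Qed.

HB.instance Definition _ :=
  GRing.PzSemiRing_isNonZero.Build fsalg fsalg_oner_neq0.

Lemma fsalg_scalerAl (a : C) (f1 f2 : fsalg) : a *: (f1 * f2) = a *: f1 * f2.
Proof. by apply/val_inj/funext => x; exact: mulrA. Qed.

HB.instance Definition _ :=
  GRing.Lmodule_isLalgebra.Build C fsalg fsalg_scalerAl.
HB.instance Definition _ := GRing.Lalgebra_isComAlgebra.Build C fsalg.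

Definition fsalg_fun (f : fsalg) : G -> C := val f.
Coercion fsalg_fun : fsalg >-> Funclass.

(* B_0(G) *)
Definition fsalg0_pred : {pred fsalg} :=
  [pred f : fsalg | `[< vanishes_at_infinity f >]].
Definition fsalg0 : Type := {f : fsalg | f \in fsalg0_pred}.

HB.instance Definition _ := SubChoice.on fsalg0.

Lemma fsalg0P (f : fsalg) :
  reflect (vanishes_at_infinity f) (f \in fsalg0_pred).
Proof. by rewrite inE; exact: asboolP. Qed.

Lemma fsalg0_subsemimod_closed : subsemimod_closed fsalg0_pred.
Proof.
split; first split.
- by apply/fsalg0P; exact: (@vanishes_at_infinity0 R G).
- move=> f1 f2 /fsalg0P f10 /fsalg0P f20; apply/fsalg0P.
  exact: (vanishes_at_infinityD f10 f20).
- move=> a f /fsalg0P f0; apply/fsalg0P.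
  by have := vanishes_at_infinityZ a f0.
Qed.

Lemma fsalg0_zmod_closed : zmod_closed fsalg0_pred.
Proof.
have [[f0 fD] fZ] := fsalg0_subsemimod_closed.
by split=> // f1 f2 f10 f20; rewrite -scaleN1r fD ?fZ.
Qed.

HB.instance Definition _ := GRing.SubChoice_isSubZmodule.Build
  fsalg fsalg0_pred fsalg0 fsalg0_zmod_closed.
HB.instance Definition _ := GRing.SubZmodule_isSubLmodule.Build
  C fsalg fsalg0_pred fsalg0 fsalg0_subsemimod_closed.

Definition fsalg0_val (f : fsalg0) : fsalg := val f.
Coercion fsalg0_val : fsalg0 >-> fsalg.

Lemma fsalg0_mul_closed (f1 f2 : fsalg0) :
  (f1 : fsalg) * (f2 : fsalg) \in fsalg0_pred.
Proof.
apply/fsalg0P; apply: vanishes_at_infinityM.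
  exact/fsalg0P/(valP f1).
exact/fsalg0P/(valP f2).
Qed.

Definition fsalg0_mul (f1 f2 : fsalg0) : fsalg0 :=
  exist (fun f => f \in fsalg0_pred) _ (fsalg0_mul_closed f1 f2).

(* The positive definite function [y |-> <lambda(y) xi, xi>], where [lambda] is
   the regular representation and [xi := delta_1 + delta_x]. *)
Lemma fsalg0_neq0 (x : G) : exists f : fsalg0, f x != 0.
Proof.
pose xi (y : G) : C := (y == 1%g)%:R + (y == x)%:R.
pose phi (y : G) : C := xi y + xi (y * x)%g.
have pphi : posdef phi.
  move=> n g c.
  pose s := undup ([seq g i | i : 'I_n] ++ [seq (g i * x)%g | i : 'I_n]).
  have us : uniq s by exact: undup_uniq.
  have gs i : g i \in s by rewrite mem_undup mem_cat fintype.image_f.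
  have gxs i : (g i * x)%g \in s.
    by rewrite mem_undup mem_cat (fintype.image_f (fun i => g i * x)%g) ?orbT.
  pose F y := \sum_(i < n) c i * xi ((g i)^-1 * y)%g.
  have xiC y : (xi y)^* = xi y by rewrite /xi rmorphD /= !rmorph_nat.
  have sumE (k : G -> C) i :
      \sum_(y <- s) xi ((g i)^-1 * y)%g * k y = k (g i) + k (g i * x)%g.
    have one z : z \in s -> \sum_(y <- s) (y == z)%:R * k y = k z.
      move=> zs; rewrite (bigD1_seq z) //= eqxx mul1r big1 ?addr0 // => y.
      by move=> /negPf ->; rewrite mul0r.
    rewrite -(one (g i)) // -(one (g i * x)%g) // -big_split /=.
    apply: eq_bigr => y _; rewrite -mulrDl; congr ((_%:R + _%:R) * _).
      by rewrite -(inj_eq (mulgI (g i))) mulVKg mulg1.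
    by rewrite -(inj_eq (mulgI (g i))) mulVKg.
  have -> : \sum_(i < n) \sum_(j < n) c i * (c j)^* * phi ((g j)^-1 * g i)%g =
      \sum_(y <- s) F y * (F y)^*.
    transitivity (\sum_(i < n) \sum_(j < n) \sum_(y <- s)
        c i * (c j)^* * (xi ((g i)^-1 * y)%g * xi ((g j)^-1 * y)%g)).
      apply: eq_bigr => i _; apply: eq_bigr => j _.
      by rewrite -mulr_sumr (sumE (fun y => xi ((g j)^-1 * y)%g)) /phi mulgA.
    under eq_bigr do rewrite exchange_big /=.
    rewrite exchange_big /=; apply: eq_bigr => y _.
    rewrite /F rmorph_sum mulr_suml; apply: eq_bigr => i _.
    rewrite mulr_sumr; apply: eq_bigr => j _.
    by rewrite rmorphM /= xiC; ring.
  by apply: sumr_ge0 => y _; rewrite -normCK exprn_ge0.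
have phi0 : vanishes_at_infinity phi.
  move=> e e0.
  apply: (@sub_finite_set _ _ [set` [:: 1; x; x^-1; x * x^-1]%g]) => //.
  move=> y /=; apply: contraPT; rewrite !inE !negb_or.
  case/and4P=> /negPf y1 /negPf yx yV yxV.
  rewrite /phi /xi y1 yx.
  have -> : (y * x == 1)%g = false.
    apply/negP => /eqP/(canRL (mulgK _)); rewrite mul1g => E.
    by rewrite E eqxx in yV.
  have -> : (y * x == x)%g = false.
    by apply/negP => /eqP/(canRL (mulgK _)) E; rewrite E eqxx in yxV.
  by rewrite !addr0 normr0 => /(lt_le_trans e0); rewrite ltxx.
have Bphi : phi \in fourier_stieltjes R G.
  by rewrite inE; exact: fourier_stieltjes_posdef.
have B0phi : (exist (fun f => f \in fourier_stieltjes R G) phi Bphi : fsalg) \in fsalg0_pred.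
  exact/fsalg0P.
exists (exist (fun f => f \in fsalg0_pred) _ B0phi).
rewrite -[X in X != 0]/(phi x) /phi /xi eqxx -!natrD.
by rewrite pnatr_eq0 addnC addnA addn1.
Qed.

(* The Gelfand space of B_0(G) *)
Definition gelfand_fsalg0 : set {ptws fsalg0 -> C} :=
  gelfand_space fsalg0_mul.

Lemma point_eval_subproof (x : G) :
  (fun f : fsalg0 => f x : C) \in gelfand_fsalg0.
Proof.
by rewrite inE; split=> //; exact: fsalg0_neq0.
Qed.

(* The map identifying [G] with a set of characters of B_0(G). *)
Definition point_eval (x : G) : gelfand_fsalg0 :=
  exist (fun chi => chi \in gelfand_fsalg0) _
    (point_eval_subproof x).

Definition natural_spectrum (f : fsalg) : Prop :=
  spectrum f = closure (range f).

End FourierStieltjesAlgebra.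

(* Main.v *)
Require Import Defs.
From HB Require Import structures.
From mathcomp Require Import all_boot all_order all_algebra.
From mathcomp Require Import complex.
From mathcomp Require Import all_classical all_reals.
From mathcomp Require Import topology normedtype.
From mathcomp Require Import ring lra zify.

(* Normed by the infimum of [sum |a_i| phi_i(1)] over decompositions [sum a_i
   phi_i] into positive definite functions, [B(G)] is submultiplicative, since
   products of positive definite functions are positive definite. If [g] in
   [B_0(G)] satisfies [|g| <= 1/2] on [G] while the norms of its powers stay
   bounded below, then some character [chi] of [B(G)] has [|chi g| >= 1], so
   that [chi g] is in the spectrum of [g] but far from [g(G)], and [chi] is
   far from all evaluations.

   The function [g] is a Riesz product minus its value at 1. In an infinite
   abelian subgroup pick a dissociate sequence [x_k] and let [f = prod_k (1 +
   b_k (x_k + x_k^-1))], viewed in the group algebra, so that [f] is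
   multiplicative along [x_k] with [f(x_k) = beta_k], where [beta_k] tends to
   0 but [sum_k beta_k^n] diverges for every [n]; put [g = f - delta_1], so
   that [g^n = f^n - delta_1]. The group algebra element [prod_k (1 + i t_k
   (x_k + x_k^-1))] has norm at most [prod_k (1 + 4 t_k^2)^(1/2)] and pairs
   with [f^n] to [prod_k (1 + 2 i t_k beta_k^n)] and with [delta_1] to 1.
   Taking [t_k] proportional to [beta_k^n] keeps the norm bounded and the
   pairing with [g^n] bounded below, uniformly in [n].

   The character comes from a minimal seminorm [q] among those that are
   submultiplicative, satisfy [q(x)^2 <= q(x^2)] and [q(g) >= 1]: minimality
   makes [q] multiplicative, and an elementary form of the Gelfand-Mazur
   theorem shows that modulo its kernel every element is a scalar. *)

Set Implicit Arguments.
Unset Strict Implicit.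
Unset Printing Implicit Defensive.

Import Order.TTheory GRing.Theory Num.Theory.
Import numFieldNormedType.Exports.
Import Normc.

Local Open Scope classical_set_scope.
Local Open Scope ring_scope.

(** * Multiplicative seminorms and characters *)

Lemma normc_ge0 (R : realType) (z : Cx R) : 0 <= normc z.
Proof. by rewrite -ler0c -[X in _ <= X]/(`|z|) normr_ge0. Qed.

Lemma lt_ler_pM (R : realType) (a x y : R) :
  (forall b, x < b -> 0 < b -> a <= b * y) -> 0 <= x -> 0 <= y -> a <= x * y.
Proof.
move=> h x0 y0; apply/ler_addgt0Pr => e e0.
have y1 : 0 < y + 1 by lra.
have b0 : 0 < e / (y + 1) by rewrite divr_gt0.
apply: le_trans (h (x + e / (y + 1)) _ _) _; [lra|lra|].
rewrite mulrDl lerD2l mulrAC ler_pdivrMr // ler_pM2l //; lra.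
Qed.

Section SpectralSeminorm.
Variables (R : realType) (A : comAlgType (Cx R)) (g : A).
Implicit Types (x y : A) (a b : R) (z : Cx R).

Record spectral_seminorm (q : A -> R) : Prop := SpectralSeminorm {
  ss_ge0 : forall x, 0 <= q x;
  ssD : forall x y, q (x + y) <= q x + q y;
  ssZ : forall z x, q (z *: x) <= normc z * q x;
  ssM : forall x y, q (x * y) <= q x * q y;
  ssX2 : forall x, q x ^+ 2 <= q (x ^+ 2);
  ss_ge1 : 1 <= q g }.

(** [P x a] reads as: [a] is an admissible bound for [x]. The conditions make the infimum of the
    bounds a spectral seminorm; the strict [normc z < b] in [sgZ] keeps bounds positive even when
    [z] is 0. *)
Record spectral_gauge (P : A -> R -> Prop) : Prop := SpectralGauge {
  sg_gt0 : forall x a, P x a -> 0 < a;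
  sg_ex : forall x, exists a, P x a;
  sgD : forall x y a b, P x a -> P y b -> P (x + y) (a + b);
  sgZ : forall z x a b, P x a -> normc z < b -> P (z *: x) (b * a);
  sgM : forall x y a b, P x a -> P y b -> P (x * y) (a * b);
  sgX2 : forall x a, P (x ^+ 2) a -> P x (Num.sqrt a);
  sg_ge1 : forall a, P g a -> 1 <= a }.

Definition gauge_inf (P : A -> R -> Prop) (x : A) : R := inf [set a | P x a].

Section Gauge.
Variable P : A -> R -> Prop.
Hypothesis sgP : spectral_gauge P.

Lemma gauge_inf_ge x b : (forall a, P x a -> b <= a) -> b <= gauge_inf P x.
Proof.
move=> h; apply: lb_le_inf; last by move=> a; exact: h.
by have [a Pa] := sg_ex sgP x; exists a.
Qed.

Lemma gauge_inf_le x a : P x a -> gauge_inf P x <= a.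
Proof.
move=> Pa; apply: ge_inf => //; exists 0 => b /(sg_gt0 sgP); exact: ltW.
Qed.

Lemma gauge_inf_lt x b : gauge_inf P x < b -> exists2 a, P x a & a < b.
Proof.
rewrite -subr_gt0 => b0; have [|a Pa] := @inf_adherent _ [set a | P x a] _ b0.
  by split; [exact: sg_ex sgP x|exists 0 => a /(sg_gt0 sgP)/ltW].
by rewrite -/(gauge_inf P x) subrKC; exists a.
Qed.

Lemma gauge_inf_seminorm : spectral_seminorm (gauge_inf P).
Proof.
have q0 x : 0 <= gauge_inf P x.
  by apply: gauge_inf_ge => a /(sg_gt0 sgP)/ltW.
split=> // [x y|z x|x y|x|].
- rewrite -lerBlDr; apply: gauge_inf_ge => a Pa.
  rewrite lerBlDr -lerBlDl; apply: gauge_inf_ge => b Pb.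
  by rewrite lerBlDl; apply: gauge_inf_le; exact: (sgD sgP).
- apply: lt_ler_pM => //; last by rewrite normc_ge0.
  move=> b zb b0; rewrite -ler_pdivrMl //; apply: gauge_inf_ge => a Pa.
  by rewrite ler_pdivrMl //; apply: gauge_inf_le; exact: (sgZ sgP).
- apply: lt_ler_pM => // b xb b0; have [a Pa ab] := gauge_inf_lt xb.
  have a0 := sg_gt0 sgP Pa.
  apply: (@le_trans _ _ (a * gauge_inf P y)); last by rewrite ler_wpM2r ?(ltW ab).
  rewrite -ler_pdivrMl //; apply: gauge_inf_ge => c Pc; rewrite ler_pdivrMl //.
  by apply: gauge_inf_le; exact: (sgM sgP).
- apply: gauge_inf_ge => a Pa; have a0 := sg_gt0 sgP Pa.
  rewrite -(sqr_sqrtr (ltW a0)) lerXn2r ?nnegrE ?sqrtr_ge0 //.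
  by apply: gauge_inf_le; exact: (sgX2 sgP).
- by apply: gauge_inf_ge => a; exact: (sg_ge1 sgP).
Qed.

End Gauge.

(** Bernoulli's inequality applied to [a^-1 = 1 + d]. *)
Lemma exists_expr_lt (a e : R) : 0 <= a < 1 -> 0 < e -> exists n, a ^+ n < e.
Proof.
move=> /andP[a0 a1] e0.
have [->|an0] := eqVneq a 0; first by exists 1%N; rewrite expr1.
have {an0}a0 : 0 < a by rewrite lt_neqAle eq_sym an0.
have [d d0 aE] : exists2 d, 0 < d & a^-1 = 1 + d.
  by exists (a^-1 - 1); rewrite ?subrKC // subr_gt0 invf_gt1.
have bern n : 1 + n%:R * d <= a^-1 ^+ n.
  elim: n => [|n IH]; first by rewrite mul0r addr0 expr0.
  rewrite exprSr; apply: (le_trans _ (ler_wpM2r _ IH)); last by rewrite invr_ge0 ltW.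
  rewrite {}aE mulrS -subr_ge0 (_ : _ - _ = n%:R * d * d); last by ring.
  by rewrite !mulr_ge0 ?(ltW d0).
have /archi_boundP : 0 <= e^-1 / d by rewrite divr_ge0 ?invr_ge0 ?ltW.
set n := Num.bound _ => ndE; exists n.
rewrite -[_ ^+ n]invrK -exprVn invf_plt ?posrE ?exprn_gt0 ?invr_gt0 //.
apply: lt_le_trans (bern n); rewrite ltr_pdivrMr // in ndE.
by rewrite (lt_trans ndE) // ltrDr.
Qed.

(** [B x a] reads as: the norm of [x] is at most [a]. *)
Record norm_bound (B : A -> R -> Prop) : Prop := NormBound {
  nb_ge0 : forall x a, B x a -> 0 <= a;
  nb_ex : forall x, exists a, B x a;
  nb_le : forall x a b, B x a -> a <= b -> B x b;
  nbD : forall x y a b, B x a -> B y b -> B (x + y) (a + b);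
  nbZ : forall z x a, B x a -> B (z *: x) (normc z * a);
  nbM : forall x y a b, B x a -> B y b -> B (x * y) (a * b) }.

(** * The spectral radius as a seminorm *)

Section SpectralRadius.
Variables (B : A -> R -> Prop) (c : R).
Hypotheses (nbB : norm_bound B) (c_gt0 : 0 < c).
Hypothesis g_ge : forall n a, B (g ^+ n.+1) a -> c <= a.

Lemma nb_sum n (F : 'I_n -> A) (G : 'I_n -> R) :
  (forall i, B (F i) (G i)) -> B (\sum_i F i) (\sum_i G i).
Proof.
move=> h; have B0 : B 0 0.
  have [a Ba] := nb_ex nbB 0.
  by have := nbZ nbB 0 Ba; rewrite scale0r normc0 mul0r.
by apply: (big_ind2 (fun x a => B x a)) => // *; exact: (nbD nbB).
Qed.

Lemma nb_muln x a n : B x a -> B (x *+ n) (a *+ n).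
Proof.
move=> Bx; rewrite -[n in x *+ n]card_ord -[n in a *+ n]card_ord.
by rewrite -!sumr_const; exact: nb_sum.
Qed.

(** The infimum of these [a] is the spectral radius of [x]; growth bounds in place of a limit of
    n-th roots make sums and products direct. *)
Definition radius_bound x a := 0 < a /\ exists K, forall n, B (x ^+ n) (K * a ^+ n).

Lemma spectral_radius_gauge : spectral_gauge radius_bound.
Proof.
split.
- by move=> x a [].
- move=> x; have [a Ba] := nb_ex nbB x; have [e Be] := nb_ex nbB 1.
  have a0 := nb_ge0 nbB Ba; have e0 := nb_ge0 nbB Be.
  exists (a + 1); split; first by rewrite ltr_wpDl.
  exists e; elim=> [|n IH]; first by rewrite !expr0 mulr1.
  rewrite !exprS; apply: (nb_le nbB (nbM nbB Ba IH)).
  rewrite mulrCA ler_wpM2l // ler_wpM2r ?exprn_ge0 ?addr_ge0 //.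
  by rewrite lerDl.
- move=> x y a b [a0 [K hK]] [b0 [L hL]]; split; first exact: addr_gt0.
  (* The binomial formula combines the two growth bounds into [K * L * (a + b) ^+ n]. *)
  exists (K * L) => n; rewrite !exprDn mulr_sumr; apply: nb_sum => i.
  rewrite [K * L * _]mulrnAr mulrACA.
  exact: (nb_muln 'C(n, i) (nbM nbB (hK (n - i)%N) (hL i))).
- move=> z x a b [a0 [K hK]] zb; have z0 := normc_ge0 z.
  have b0 := le_lt_trans z0 zb; split; first exact: mulr_gt0.
  exists K => n; rewrite exprZn exprMn.
  apply: (nb_le nbB (nbZ nbB _ (hK n))).
  have K0 : 0 <= K by have := nb_ge0 nbB (hK 0%N); rewrite expr0 mulr1.
  rewrite mulrCA ler_wpM2l // ler_wpM2r ?exprn_ge0 ?(ltW a0) //.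
  have -> : normc (z ^+ n) = normc z ^+ n.
    by elim: (n) => [|m IH]; rewrite ?normc1 // !exprS normcM IH.
  by rewrite lerXn2r ?nnegrE // ltW.
- move=> x y a b [a0 [K hK]] [b0 [L hL]]; split; first exact: mulr_gt0.
  by exists (K * L) => n; rewrite !exprMn mulrACA; exact: (nbM nbB).
- move=> x a [a0 [K hK]]; have [e Be] := nb_ex nbB x.
  have e0 := nb_ge0 nbB Be.
  have K0 : 0 <= K by have := nb_ge0 nbB (hK 0%N); rewrite expr0 mulr1.
  have s0 : 0 < Num.sqrt a by rewrite sqrtr_gt0.
  (* Even powers of [x] are powers of [x ^+ 2]; an odd power has one extra factor [x], of norm at
     most [e], traded for one factor [Num.sqrt a]. *)
  split=> //; exists (K + K * e / Num.sqrt a) => n.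
  have sE m : a ^+ m = Num.sqrt a ^+ m.*2.
    by rewrite -[in LHS](sqr_sqrtr (ltW a0)) -exprM mul2n.
  have := hK n./2; rewrite sE -exprM mul2n => h.
  have p0 : 0 <= K * e / Num.sqrt a by rewrite divr_ge0 ?mulr_ge0 ?(ltW s0).
  rewrite -[n in x ^+ n]odd_double_half -[n in _ * _ ^+ n]odd_double_half.
  case: (odd n) => /=; rewrite ?add1n ?add0n.
    rewrite 2!exprS; apply: (nb_le nbB (nbM nbB Be h)).
    rewrite mulrDl -[leLHS]add0r lerD //.
      by rewrite !mulr_ge0 // ?exprn_ge0 // ltW.
    by rewrite mulrA mulrA mulfVK ?gt_eqF // [e * K]mulrC.
  by apply: (nb_le nbB h); rewrite ler_wpM2r ?exprn_ge0 ?(ltW s0) // lerDl.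
- move=> a [a0 [K hK]]; rewrite leNgt; apply/negP => a1.
  have cK n : c <= K * a ^+ n.+1 := g_ge (hK n.+1).
  have K0 : 0 < K.
    by have := lt_le_trans c_gt0 (cK 0%N); rewrite pmulr_lgt0 ?exprn_gt0.
  have [|n] := @exists_expr_lt a (c / K) _ (divr_gt0 c_gt0 K0).
    by rewrite ltW.
  rewrite ltr_pdivlMr // mulrC; apply/negP; rewrite -leNgt.
  apply: le_trans (cK n) _; rewrite ler_wpM2l ?(ltW K0) //.
  by rewrite exprS ler_piMl ?exprn_ge0 ?(ltW a0) ?(ltW a1).
Qed.

End SpectralRadius.

(** Zorn's lemma for the reversed order: [q0] bounds the empty chain, and the pointwise infimum
    bounds a nonempty one. *)
Lemma exists_minimal_seminorm (q0 : A -> R) : spectral_seminorm q0 ->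
  exists2 q, spectral_seminorm q &
    forall q', spectral_seminorm q' -> (forall x, q' x <= q x) -> q' = q.
Proof.
move=> ss0; pose T := {q : A -> R | spectral_seminorm q}.
pose le (s t : T) := `[< forall x, sval t x <= sval s x >].
have [|r s t /asboolP rs /asboolP st|[s ps] [t pt]|F totF|q qmin] := @Zorn T le.
- by move=> t; apply/asboolP.
- by apply/asboolP => x; exact: le_trans (st x) (rs x).
- move=> /asboolP /= st /asboolP /= ts; apply: eq_exist.
  by apply/funext => x; apply/le_anti; rewrite st ts.
- have [/eqP ->|/set0P[q1 Fq1]] := boolP (F == set0).
    by exists (exist _ q0 ss0).
  (* In a chain, bounds reached by two members are both reached by the smaller one. *)
  have both q q' : F q -> F q' -> exists2 q'', F q'' &
      forall x, sval q'' x <= sval q x /\ sval q'' x <= sval q' x.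
    move=> Fq Fq'; have [/asboolP|/asboolP] := totF _ _ Fq Fq' => h.
      by exists q'.
    by exists q.
  pose P x a := 0 < a /\ exists2 q, F q & sval q x <= a.
  have sgP : spectral_gauge P.
    split.
    + by move=> x a [].
    + move=> x; have := ss_ge0 (svalP q1) x.
      by exists (sval q1 x + 1); split; [lra|exists q1 => //; lra].
    + move=> x y a b [a0 [q Fq qx]] [b0 [q' Fq' qy]].
      have [q'' Fq'' h] := both _ _ Fq Fq'.
      split; first exact: addr_gt0.
      exists q'' => //; apply: le_trans (ssD (svalP q'') _ _) _.
      by rewrite lerD // (le_trans _ qx, le_trans _ qy) //; have [] := h x; have [] := h y.
    + move=> z x a b [a0 [q Fq qx]] zb; have z0 := normc_ge0 z.
      split; first by rewrite mulr_gt0 // (le_lt_trans z0).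
      exists q => //; apply: le_trans (ssZ (svalP q) _ _) _.
      by rewrite ler_pM ?(ss_ge0 (svalP q)) // ltW.
    + move=> x y a b [a0 [q Fq qx]] [b0 [q' Fq' qy]].
      have [q'' Fq'' h] := both _ _ Fq Fq'.
      split; first exact: mulr_gt0.
      exists q'' => //; apply: le_trans (ssM (svalP q'') _ _) _.
      have [hx _] := h x; have [_ hy] := h y.
      by rewrite ler_pM ?(ss_ge0 (svalP q'')) ?(le_trans hx) ?(le_trans hy).
    + move=> x a [a0 [q Fq qx]]; split; first by rewrite sqrtr_gt0.
      exists q => //; rewrite -[leLHS]ger0_norm ?(ss_ge0 (svalP q)) // -sqrtr_sqr.
      by rewrite ler_wsqrtr // (le_trans (ssX2 (svalP q) _)).
    + by move=> a [a0 [q Fq]]; exact: le_trans (ss_ge1 (svalP q)).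
  exists (exist _ _ (gauge_inf_seminorm sgP)) => q Fq; apply/asboolP => x /=.
  apply/ler_addgt0Pr => e e0; apply: gauge_inf_le sgP _ _ _.
  have := ss_ge0 (svalP q) x.
  by split; [lra|exists q => //; lra].
exists (sval q); first exact: svalP.
move=> q' ssq' q'q; have <- // := qmin (exist _ q' ssq').
exact/asboolP.
Qed.

(** * Minimal seminorms are multiplicative *)

Section MinimalSeminorm.
Variable q : A -> R.
Hypothesis ssq : spectral_seminorm q.

Lemma ss_one : q 1 = 1.
Proof.
have g0 : 0 < q g by apply: lt_le_trans (ss_ge1 ssq).
have q1 : 1 <= q 1.
  by rewrite -(ler_pM2r g0) mul1r -{1}[g]mul1r (ssM ssq).
apply/le_anti; rewrite q1 andbT.
have := ss_ge0 ssq 1; rewrite le0r => /orP[/eqP->//|q0].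
by rewrite -(ler_pM2r q0) mul1r -expr2 (le_trans (ssX2 ssq 1)) // expr1n.
Qed.

(** The square inequality gives the dyadic powers; for the others, [x ^+ n] is a factor of
    [x ^+ (2 ^ n)], and the bound on the cofactor cancels. *)
Lemma ssX x n : q (x ^+ n) = q x ^+ n.
Proof.
have up m : q (x ^+ m) <= q x ^+ m.
  elim: m => [|m IH]; first by rewrite ss_one.
  by rewrite !exprS (le_trans (ssM ssq _ _)) // ler_wpM2l ?(ss_ge0 ssq).
have := ss_ge0 ssq x; rewrite le0r => /orP[/eqP q0|q0].
  case: n => [|n]; first by rewrite ss_one.
  apply/le_anti; rewrite up /= q0 expr0n /=; exact: ss_ge0 ssq _.
have dyadic k : q x ^+ (2 ^ k) <= q (x ^+ (2 ^ k)).
  elim: k => [|k IH]; first by rewrite !expr1.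
  rewrite expnSr !exprM; apply: le_trans (ssX2 ssq _).
  by rewrite lerXn2r // nnegrE ?exprn_ge0 ?(ss_ge0 ssq).
apply/le_anti; rewrite up /=.
have n2 := ltnW (ltn_expl n (ltnSn 1)).
rewrite -(ler_pM2r (exprn_gt0 (2 ^ n - n) q0)) -exprD subnKC //.
apply: le_trans (dyadic n) _; rewrite -{1}(subnKC n2) exprD.
by rewrite (le_trans (ssM ssq _ _)) // ler_wpM2l ?(ss_ge0 ssq).
Qed.

(** The infimum of these [t] is the limit of [q (a ^+ n * x) / q a ^+ n], which is nonincreasing in
    [n]. *)
Definition translate_bound (a x : A) (t : R) :=
  0 < t /\ exists n, q (a ^+ n * x) <= t * q a ^+ n.

Lemma translate_gauge (a : A) : 0 < q a -> (forall n, q a ^+ n <= q (a ^+ n * g)) ->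
  spectral_gauge (translate_bound a).
Proof.
move=> a0 ag; have an0 n := exprn_gt0 n a0.
(* Monotonicity moves bounds found at different exponents to a common one. *)
have mono x t n m : q (a ^+ n * x) <= t * q a ^+ n ->
    q (a ^+ (m + n) * x) <= t * q a ^+ (m + n).
  move=> h; rewrite !exprD -mulrA [leRHS]mulrCA (le_trans (ssM ssq _ _)) //.
  by rewrite ssX ler_wpM2l // (ltW (an0 m)).
split.
- by move=> x t [].
- move=> x; have x0 := ss_ge0 ssq x.
  exists (q x + 1); split; first by rewrite ltr_wpDl.
  by exists 0%N; rewrite !expr0 mul1r mulr1 lerDl.
- move=> x y t u [t0 [n hx]] [u0 [m hy]]; split; first exact: addr_gt0.
  exists (n + m)%N; rewrite mulrDr (le_trans (ssD ssq _ _)) // mulrDl lerD //.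
    by rewrite addnC mono.
  exact: mono.
- move=> z x t u [t0 [n hx]] zu; have z0 := normc_ge0 z.
  split; first by rewrite mulr_gt0 // (le_lt_trans z0).
  exists n; rewrite -scalerAr (le_trans (ssZ ssq _ _)) // -mulrA.
  by rewrite ler_pM ?(ss_ge0 ssq) // ltW.
- move=> x y t u [t0 [n hx]] [u0 [m hy]]; split; first exact: mulr_gt0.
  exists (n + m)%N; rewrite !exprD mulrACA (le_trans (ssM ssq _ _)) //.
  by rewrite mulrACA ler_pM ?(ss_ge0 ssq).
- move=> x t [t0 [n hx]]; split; first by rewrite sqrtr_gt0.
  exists n; rewrite -(ler_pXn2r (ltn0Sn 1)) ?nnegrE ?(ss_ge0 ssq) //; last first.
    by rewrite mulr_ge0 ?sqrtr_ge0 // ltW.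
  rewrite (le_trans (ssX2 ssq _)) // exprMn expr2 -mulrA.
  rewrite (le_trans (ssM ssq _ _)) // ssX [leRHS]exprMn sqr_sqrtr ?(ltW t0) //.
  by rewrite [in leRHS]expr2 mulrCA ler_wpM2l // (ltW (an0 n)).
- move=> t [t0 [n hn]].
  by rewrite -(ler_pM2r (an0 n)) mul1r (le_trans (ag n)).
Qed.

Hypothesis minq : forall q', spectral_seminorm q' ->
  (forall x, q' x <= q x) -> q' = q.

(** The limit seminorm of [translate_bound] is at most [q] (exponent 0), so by minimality it is [q];
    exponent 1 bounds its value at [x] by [q (a * x) / q a]. *)
Lemma minimal_translate (a : A) : 0 < q a -> (forall n, q a ^+ n <= q (a ^+ n * g)) ->
  forall x, q (a * x) = q a * q x.
Proof.
move=> a0 ag x; have sgP := translate_gauge a0 ag.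
apply/le_anti; rewrite (ssM ssq) /=.
rewrite -ler_pdivlMl // -[in leLHS](minq (gauge_inf_seminorm sgP)); last first.
  move=> y; apply/ler_addgt0Pr => e e0; apply: gauge_inf_le => //.
  have y0 := ss_ge0 ssq y; split; first by rewrite ltr_wpDl.
  by exists 0%N; rewrite !expr0 mul1r mulr1 lerDl ltW.
apply/ler_addgt0Pr => e e0; apply: gauge_inf_le => //.
have ax0 := ss_ge0 ssq (a * x).
split; first by rewrite ltr_wpDl // mulr_ge0 // invr_ge0 ltW.
exists 1%N; rewrite !expr1 mulrDl mulrAC mulVf ?gt_eqF // mul1r.
by rewrite lerDl mulr_ge0 ?ltW.
Qed.

Lemma minimal_multiplicative x y : q (x * y) = q x * q y.
Proof.
have := ss_ge0 ssq x; rewrite le0r => /orP[/eqP q0|q0].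
  apply/le_anti; rewrite (ssM ssq) q0 mul0r; exact: ss_ge0 ssq _.
have g1 := ss_ge1 ssq; have g0 := lt_le_trans ltr01 g1.
(* The lower bound required on powers holds for [g] because [1 <= q g]; multiplicativity along [g]
   then supplies it for [x]. *)
apply: minimal_translate => // n; rewrite mulrC minimal_translate //.
  by rewrite ssX ler_peMl // exprn_ge0 // ltW.
by move=> m; rewrite -exprSr !ssX exprSr ler_peMr // exprn_ge0 // ltW.
Qed.

End MinimalSeminorm.

End SpectralSeminorm.

(** * An elementary Gelfand-Mazur theorem *)

Section MultiplicativeSeminorm.
Variables (R : realType) (A : comAlgType (Cx R)) (q : A -> R).
Hypotheses (q_ge0 : forall x, 0 <= q x) (qD : forall x y, q (x + y) <= q x + q y).
Hypotheses (qZ1 : forall z : Cx R, q (z *: 1) = normc z).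
Hypothesis qM : forall x y, q (x * y) = q x * q y.
Implicit Types (x y : A) (z l : Cx R).

Lemma msX x n : q (x ^+ n) = q x ^+ n.
Proof.
elim: n => [|n IH]; first by rewrite !expr0 -[1 : A]scale1r qZ1 normc1.
by rewrite !exprS qM IH.
Qed.

Lemma msN x : q (- x) = q x.
Proof.
rewrite -[- x]mulN1r qM -scaleN1r qZ1 (_ : normc _ = 1) ?mul1r //.
exact: etrans (normcN 1) (normc1 R).
Qed.

Lemma ms_dist x l l' : normc (l - l') <= q (x - l *: 1) + q (x - l' *: 1).
Proof.
rewrite -qZ1 -[X in _ <= X + _]msN (le_trans _ (qD _ _)) //.
by rewrite opprB addrA subrK scalerBl.
Qed.

Section LowerBound.
Variables (x : A) (m : R).
Hypotheses (m_gt0 : 0 < m) (qx_ge : forall l, m <= q (x - l *: 1)).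

(** Successive square roots of [l] split [x ^+ (2 ^ k) - l *: 1] into [2 ^ k] factors of the form
    [x - z *: 1]. *)
Lemma ms_dyadic_ge k l : m ^+ (2 ^ k) <= q (x ^+ (2 ^ k) - l *: 1).
Proof.
elim: k l => [|k IH] l; first by rewrite !expr1.
have -> : l = sqrtC l ^+ 2 by rewrite sqrtCK.
have -> : x ^+ (2 ^ k.+1) - sqrtC l ^+ 2 *: 1 =
    (x ^+ (2 ^ k) - sqrtC l *: 1) * (x ^+ (2 ^ k) - (- sqrtC l) *: 1).
  by rewrite scaleNr opprK -subr_sqr -exprM -expnSr exprZn expr1n.
by rewrite qM expnSr exprM expr2 ler_pM ?exprn_ge0 ?(ltW m_gt0).
Qed.

(* [x^N - l^N] is the product of [x - l] and of [N - 1] further factors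
   [x - z l] with [z^N = 1], each of seminorm at least [m]. *)
Lemma ms_dyadic_le k l : q (x - l *: 1) * m ^+ (2 ^ k).-1 <=
  q x ^+ (2 ^ k) + normc l ^+ (2 ^ k).
Proof.
apply: (@le_trans _ _ (q (x ^+ (2 ^ k) - (l ^+ (2 ^ k)) *: 1))); last first.
  rewrite (le_trans (qD _ _)) // msN msX qZ1 lerD2l.
  by elim: (2 ^ k)%N => [|n IH]; rewrite ?normc1 // !exprS normcM ler_wpM2l // normc_ge0.
elim: k => [|k IH]; first by rewrite !expr1 mulr1.
have -> : x ^+ (2 ^ k.+1) - l ^+ (2 ^ k.+1) *: 1 =
    (x ^+ (2 ^ k) - l ^+ (2 ^ k) *: 1) * (x ^+ (2 ^ k) - (- l ^+ (2 ^ k)) *: 1).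
  by rewrite scaleNr opprK -subr_sqr exprZn expr1n -!exprM -expnSr.
have -> : (2 ^ k.+1).-1 = ((2 ^ k).-1 + 2 ^ k)%N.
  by rewrite expnSr; have := expn_gt0 2 k; lia.
rewrite exprD mulrA qM ler_pM ?mulr_ge0 ?exprn_ge0 ?(ltW m_gt0) //.
exact: ms_dyadic_ge.
Qed.

End LowerBound.

Lemma expr1D_le (a : R) n : 0 <= a <= 1 -> (1 + a) ^+ n <= 1 + 3 ^+ n * a.
Proof.
move=> /andP[a0 a1]; elim: n => [|n IH]; first by rewrite !expr0; lra.
rewrite exprSr (le_trans (ler_wpM2r _ IH)) ?addr_ge0 //.
have : (1 : R) <= 3 ^+ n by rewrite exprn_ege1 // ler1n.
rewrite [3 ^+ n.+1]exprS; move: (3 ^+ n : R) => t t1.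
rewrite -subr_ge0 (_ : _ - _ = t * (a * (1 - a)) + a * (t - 1)); last by ring.
by rewrite addr_ge0 ?mulr_ge0 ?subr_ge0 // (le_trans ler01).
Qed.

(** With [N = 2 ^ k], [ms_dyadic_le] bounds [q (x - l *: 1)] by [m * ((1 + u) ^+ N + 2^-1 ^+ N)].
    First [N] makes the last term small, then [u], depending on [N], brings the first one near 1. *)
Lemma ms_step (m e : R) : 0 < m -> 0 < e -> exists d, [/\ 0 < d, d <= e &
  forall x l, (forall z, m <= q (x - z *: 1)) -> q x < m + d ->
    normc l = m / 2 -> q (x - l *: 1) < m + e].
Proof.
move=> m0 e0; have em0 : 0 < e / m by rewrite divr_gt0.
have em2 : 0 < e / m / 2 by rewrite divr_gt0.
have [|k kE] := @exists_expr_lt R 2^-1 _ _ em2.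
  by rewrite invr_ge0 invf_lt1 ?ltr1n // ler0n.
 pose N := (2 ^ k)%N.
have NE : 2^-1 ^+ N < e / m / 2.
  apply: le_lt_trans kE; rewrite ler_wiXn2l ?invr_ge0 ?ler0n //.
    by rewrite invf_le1 ?ler1n.
  exact: ltnW (ltn_expl _ _).
pose u := Num.min 1 (Num.min (e / m) (e / m / 2 / 3 ^+ N)).
have u0 : 0 < u by rewrite !lt_min ltr01 em0 !divr_gt0 ?exprn_gt0.
have u1 : u <= 1 by rewrite ge_min lexx.
have ue : u <= e / m by rewrite !ge_min lexx orbT.
have uN : 3 ^+ N * u <= e / m / 2.
  by rewrite mulrC -ler_pdivlMr ?exprn_gt0 // !ge_min lexx !orbT.
exists (u * m); split; [exact: mulr_gt0|by rewrite -ler_pdivlMr|].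
move=> x l xm xu lm.
have N0 : (0 < N)%N by rewrite expn_gt0.
have mN : m ^+ N = m ^+ N.-1 * m by rewrite -exprSr prednK.
have p0 : 0 < m ^+ N.-1 by rewrite exprn_gt0.
rewrite -(ltr_pM2r p0); apply: le_lt_trans (ms_dyadic_le m0 xm k l) _.
rewrite -/N lm exprMn.
have h1 : q x ^+ N <= m ^+ N * (1 + u) ^+ N.
  rewrite -exprMn lerXn2r ?nnegrE ?q_ge0 ?mulr_ge0 ?addr_ge0 ?(ltW u0) ?(ltW m0) //.
  by rewrite mulrDr mulr1 mulrC ltW // mulrC [m * u]mulrC.
have h2 : (1 + u) ^+ N <= 1 + e / m / 2.
  by apply: le_trans (expr1D_le _ _) _; rewrite ?(ltW u0) ?u1 // lerD2l.
apply: (@lt_le_trans _ _ (m ^+ N * (1 + e / m / 2 + e / m / 2))).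
  rewrite mulrDr ler_ltD //; first by rewrite (le_trans h1) // ler_pM2l ?exprn_gt0.
  by rewrite ltr_pM2l ?exprn_gt0.
rewrite -addrA -splitr mN -mulrA [leRHS]mulrC ler_pM2l //.
by rewrite mulrDr mulr1 mulrC divfK ?gt_eqF.
Qed.

(* If [m > 0], near-minimality of [q (x - l)] would propagate from [l] to
   [l + m / 2], hence arbitrarily far away, where [q (x - l)] is large. *)
Lemma ms_inf_eq0 x (m : R) : (forall l, m <= q (x - l *: 1)) ->
  (forall e, 0 < e -> exists l, q (x - l *: 1) < m + e) -> m <= 0.
Proof.
move=> xm mx; rewrite leNgt; apply/negP => m0.
(* Quantifying over [e] in the induction makes the starting point accurate enough for all [k]
   steps. *)
have far k e : 0 < e -> exists2 l, q (x - l *: 1) < m + e &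
    q (x - (l + (k%:R * (m / 2))%:C%C) *: 1) < m + e.
  elim: k e => [|k IH] e e0.
    by have [l lm] := mx _ e0; exists l => //; rewrite mul0r rmorph0 addr0.
  have [d [d0 de step]] := ms_step m0 e0.
  have [l l1 l2] := IH _ d0; exists l; first by rewrite (lt_le_trans l1) ?lerD2l.
  rewrite mulrS mulrDl mul1r rmorphD addrCA addrC scalerDl opprD addrA.
  apply: step => //; first by move=> z; rewrite -addrA -opprD -scalerDl.
  by rewrite /= expr0n addr0 sqrtr_sqr gtr0_norm // divr_gt0.
(* Eight steps of [m / 2] put the two points [4 * m] apart, while both seminorms are below
   [2 * m]. *)
have [l l1 l2] := far 8%N _ m0.
have := ms_dist x (l + (8%:R * (m / 2))%:C%C) l.
rewrite addrAC subrr add0r /= expr0n addr0 sqrtr_sqr ger0_norm; lra.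
Qed.

Lemma ms_complete x : (forall e, 0 < e -> exists l, q (x - l *: 1) < e) ->
  exists l, q (x - l *: 1) = 0.
Proof.
move=> small.
(* For a 1-Lipschitz [r], the intervals of radius [q (x - l *: 1)] around [r l] meet pairwise, so
   they share a point [a]. The real and imaginary parts then give the coordinates of the limit. *)
have coord (r : Cx R -> R) : (forall l l', `|r l - r l'| <= normc (l - l')) ->
    exists a, forall l, `|a - r l| <= q (x - l *: 1).
  move=> rl; pose S := [set r l + q (x - l *: 1) | l in setT].
  have lbS l' : lbound S (r l' - q (x - l' *: 1)).
    move=> _ [l _ <-].
    have := le_trans (ler_norm _) (le_trans (rl l' l) (ms_dist x l' l)); lra.
  exists (inf S) => l; rewrite ler_norml; apply/andP; split.
    rewrite lerBrDl; apply: lb_le_inf (lbS l).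
    by exists (r 0 + q (x - 0 *: 1)), 0.
  rewrite lerBlDl; apply: ge_inf; last by exists l.
  by exists (r 0 - q (x - 0 *: 1)); exact: lbS.
have cRe (z : Cx R) : `|complex.Re z| <= normc z.
  by rewrite -lecR; exact: normc_ge_Re.
have cIm (z : Cx R) : `|complex.Im z| <= normc z.
  have := cRe (z * 'i%C); rewrite ReiNIm normrN => /le_trans; apply.
  by rewrite normcM /= expr0n expr1n add0r sqrtr1 mulr1.
have [l l'|a aP] := coord (@complex.Re R).
  by have := cRe (l - l'); case: l l' => [? ?] [? ?].
have [l l'|b bP] := coord (@complex.Im R).
  by have := cIm (l - l'); case: l l' => [? ?] [? ?].
exists (Complex a b); apply/le_anti; rewrite q_ge0 andbT.
apply/ler_addgt0Pr => e e0; rewrite add0r.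
have [|l lE] := small (e / 3); first by rewrite divr_gt0.
have -> : x - Complex a b *: 1 = (x - l *: 1) + - (Complex a b - l) *: 1.
  by rewrite scaleNr scalerBl opprB addrA subrK.
have h : normc (Complex a b - l) <= `|a - complex.Re l| + `|b - complex.Im l|.
  case: l {lE} => c d /=; rewrite -[leRHS]ger0_norm ?addr_ge0 // -sqrtr_sqr.
  rewrite ler_wsqrtr // [leRHS]sqrrD !real_normK ?num_real // addrAC lerDl.
  by rewrite mulrn_wge0 // mulr_ge0.
rewrite (le_trans (qD _ _)) // scaleNr msN qZ1.
have := aP l; have := bP l; lra.
Qed.

Lemma ms_eigenvalue x : exists l, q (x - l *: 1) = 0.
Proof.
apply: ms_complete => e e0.
pose S := [set q (x - l *: 1) | l in setT].
have infS : has_inf S.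
  split; first by exists (q (x - 0 *: 1)), 0.
  by exists 0 => _ [l _ <-].
have near d : 0 < d -> exists l, q (x - l *: 1) < inf S + d.
  by move=> /inf_adherent/(_ infS)[_ [l _ <-]]; exists l.
have S0 : inf S <= 0.
  apply: ms_inf_eq0 near => l; apply: ge_inf; last by exists l.
  by case: infS.
by have [l lE] := near e e0; exists l; lra.
Qed.

(** [chi x] is the only [l] with [q (x - l *: 1) = 0]; uniqueness yields linearity and
    multiplicativity. *)
Lemma ms_character : exists chi : A -> Cx R,
  [/\ scalar chi, forall x y, chi (x * y) = chi x * chi y &
    forall x, normc (chi x) = q x].
Proof.
have [chi chiP] := choice ms_eigenvalue.
have uniq_chi x l : q (x - l *: 1) = 0 -> chi x = l.
  move=> xl; apply/eqP; rewrite -subr_eq0; apply/eqP/eq0_normc/le_anti.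
  by rewrite normc_ge0 andbT (le_trans (ms_dist x _ _)) // chiP xl addr0.
have le0 x : q x <= 0 -> q x = 0 by move=> ?; apply/le_anti/andP.
exists chi; split.
- move=> z x y; apply: uniq_chi; apply: le0.
  have -> : z *: x + y - (z * chi x + chi y) *: 1 =
      z *: 1 * (x - chi x *: 1) + (y - chi y *: 1).
    rewrite -scalerAl mul1r scalerBr scalerA scalerDl opprD.
    by rewrite addrACA.
  by rewrite (le_trans (qD _ _)) // qM !chiP mulr0 addr0.
- move=> x y; apply: uniq_chi; apply: le0.
  have -> : x * y - (chi x * chi y) *: 1 =
      x * (y - chi y *: 1) + (chi y *: 1) * (x - chi x *: 1).
    rewrite mulrBr mulrBr -!scalerAl -!scalerAr !mul1r mulr1 scalerA.
    by rewrite addrA subrK [chi x * _]mulrC.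
  by rewrite (le_trans (qD _ _)) // !qM !chiP !mulr0 addr0.
- move=> x; apply/le_anti/andP; split.
    rewrite -qZ1 -[_ *: 1](subKr x) (le_trans (qD _ _)) // msN.
    by rewrite chiP addr0.
  rewrite -[X in q X](subrK (chi x *: 1)) (le_trans (qD _ _)) // chiP add0r.
  by rewrite qZ1.
Qed.

End MultiplicativeSeminorm.

(** The bound on powers gives [g] spectral radius at least 1, so spectral seminorms exist; a minimal
    one is the modulus of a character. *)
Lemma norm_bound_character (R : realType) (A : comAlgType (Cx R))
    (B : A -> R -> Prop) (g : A) (c : R) :
    norm_bound B -> 0 < c -> (forall n a, B (g ^+ n.+1) a -> c <= a) ->
  exists chi : A -> Cx R,
  [/\ scalar chi, forall x y, chi (x * y) = chi x * chi y & 1 <= normc (chi g)].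
Proof.
move=> nbB c0 gc.
have ss0 := gauge_inf_seminorm (spectral_radius_gauge nbB c0 gc).
have [q ssq minq] := exists_minimal_seminorm ss0.
have qM := minimal_multiplicative ssq minq.
have qZ1 z : q (z *: 1) = normc z.
  apply/le_anti/andP; split.
    by rewrite (le_trans (ssZ ssq _ _)) // (ss_one ssq) mulr1.
  have [->|z0] := eqVneq z 0; first by rewrite normc0 (ss_ge0 ssq).
  have zV : 0 < normc z^-1.
    rewrite lt_neqAle normc_ge0 andbT; apply: contra z0 => /eqP/esym/eq0_normc.
    by move/eqP; rewrite invr_eq0.
  rewrite -(ler_pM2l zV) -normcM mulVf // normc1.
  rewrite (le_trans _ (ssZ ssq _ _)) // scalerA mulVf // scale1r.
  by rewrite (ss_one ssq).
have [chi [chil chiM chiq]] := ms_character (ss_ge0 ssq) (ssD ssq) qZ1 qM.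
by exists chi; split=> //; rewrite chiq (ss_ge1 ssq).
Qed.

(** * Positive definite functions and the group algebra *)

Section Forms.
Variables (R : realType) (G : groupType).
Local Notation C := (Cx R).
Implicit Types (phi psi : G -> C) (s t d : seq (C * G)).

(* [s] stands for the element [sum_(p <- s) p.1 p.2] of the group algebra;
   [gform phi s t] and [gact d s] are then [phi (t^* s)] and [s d]. *)
Definition gform phi s t : C :=
  \sum_(p <- s) \sum_(r <- t) p.1 * (r.1)^* * phi ((r.2)^-1 * p.2)%g.

Definition gpair s phi : C := \sum_(p <- s) p.1 * phi p.2.

Definition gact d s : seq (C * G) :=
  [seq (p.1 * r.1, (p.2 * r.2)%g) | p <- s, r <- d].

Lemma posdef_gform phi s : posdef phi -> 0 <= gform phi s s.
Proof.
move=> pphi; rewrite /gform big_tnth.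
under eq_bigr do rewrite big_tnth.
exact: (pphi _ (fun i => (tnth (in_tuple s) i).2)).
Qed.

Lemma gform_posdef phi : (forall s, 0 <= gform phi s s) -> posdef phi.
Proof.
move=> h n g c; have := h [seq (c i, g i) | i <- enum 'I_n].
rewrite /gform big_map big_enum /=.
by under eq_bigr do rewrite big_map big_enum /=.
Qed.

Lemma gform_cat phi s1 s2 t1 t2 : gform phi (s1 ++ s2) (t1 ++ t2) =
  gform phi s1 t1 + gform phi s1 t2 + (gform phi s2 t1 + gform phi s2 t2).
Proof.
rewrite /gform big_cat /=; congr (_ + _); rewrite -big_split /=;
  by apply: eq_bigr => p _; rewrite big_cat.
Qed.

Lemma gform_act phi d d' s t : gform phi (gact d s) (gact d' t) =
  \sum_(r <- d) \sum_(r' <- d') r.1 * (r'.1)^* *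
    gform (fun y => phi ((r'.2)^-1 * y * r.2)%g) s t.
Proof.
rewrite /gform /gact big_allpairs_dep /=.
under eq_bigr do under eq_bigr do rewrite big_allpairs_dep /=.
under [RHS]eq_bigr do under eq_bigr do rewrite mulr_sumr.
under [RHS]eq_bigr do rewrite exchange_big /=.
rewrite [RHS]exchange_big /=; apply: eq_bigr => p _; apply: eq_bigr => r _.
under [RHS]eq_bigr do rewrite mulr_sumr.
rewrite [RHS]exchange_big /=; apply: eq_bigr => q _; apply: eq_bigr => r' _.
by rewrite rmorphM /= invgM !mulgA; ring.
Qed.

Lemma posdefD phi psi : posdef phi -> posdef psi -> posdef (phi + psi).
Proof.
move=> pphi ppsi n g c; have := addr_ge0 (pphi n g c) (ppsi n g c).
rewrite -big_split /=; congr (0 <= _); apply: eq_bigr => i _.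
by rewrite -big_split /=; apply: eq_bigr => j _; rewrite -mulrDr.
Qed.

Lemma posdefZ (a : C) phi : 0 <= a -> posdef phi -> posdef (a *: phi).
Proof.
move=> a0 pphi n g c; have := mulr_ge0 a0 (pphi n g c); congr (0 <= _).
rewrite mulr_sumr; apply: eq_bigr => i _; rewrite mulr_sumr.
by apply: eq_bigr => j _; rewrite mulrCA.
Qed.

(** With [phi] extended linearly this function is [y |-> phi (d^* y d)], whose form at [s] is that
    of [phi] at [gact d s]. *)
Lemma posdef_act phi d : posdef phi -> posdef (fun y =>
  \sum_(r <- d) \sum_(r' <- d) r.1 * (r'.1)^* * phi ((r'.2)^-1 * y * r.2)%g).
Proof.
move=> pphi; apply: gform_posdef => s.
have := posdef_gform (gact d s) pphi; rewrite gform_act /gform; congr (0 <= _).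
under eq_bigr do under eq_bigr do rewrite mulr_sumr.
under eq_bigr do rewrite exchange_big /=.
rewrite exchange_big /=; apply: eq_bigr => p _.
under eq_bigr do under eq_bigr do rewrite mulr_sumr.
under eq_bigr do rewrite exchange_big /=.
rewrite exchange_big /=; apply: eq_bigr => q _.
rewrite mulr_sumr; apply: eq_bigr => r _.
rewrite mulr_sumr; apply: eq_bigr => r' _.
by rewrite mulrCA.
Qed.

Lemma posdef_ge0 phi : posdef phi -> 0 <= phi 1%g.
Proof.
move=> /(@posdef_gform _ [:: (1, 1%g)]).
by rewrite /gform !big_seq1 /= rmorph1 !mul1r invg1 mul1g.
Qed.

(** Hermitian symmetry of the matrix of [phi] at the points 1 and [y]. *)
Lemma posdefV phi y : posdef phi -> phi (y^-1)%g = (phi y)^*.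
Proof.
move=> pphi; pose g (i : 'I_2) := if i == 0 then 1%g else y.
pose M : 'M[C]_2 := \matrix_(i, j) phi ((g j)^-1 * g i)%g.
have /(_ 1 0) : forall i j, M j i = (M i j)^*.
  apply: psd_hermitian => d; have := pphi 2 g (d 0); congr (0 <= _).
  rewrite -mulmxA !mxE; apply: eq_bigr => i _.
  rewrite !mxE mulr_sumr; apply: eq_bigr => j _.
  by rewrite !mxE mulrA mulrAC.
by rewrite !mxE /g /= mulg1 invg1 mul1g.
Qed.

(* Cauchy-Schwarz, tested against [w] with [|w| = 2] and the phase of
   [gpair s phi]. *)
Lemma gpair_le phi s : posdef phi -> gform phi s s <= 4 * phi 1%g ->
  `|gpair s phi| <= 2 * phi 1%g.
Proof.
move=> pphi hs; set z := gpair s phi.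
have [->|z0] := eqVneq z 0; first by rewrite normr0 mulr_ge0 ?posdef_ge0.
pose w : C := - 2 * (z / `|z|).
have := posdef_gform ((w, 1%g) :: s) pphi.
rewrite -cat1s gform_cat /gform !big_seq1 /= -/(gform phi s s).
under [X in _ + X + _]eq_bigr do rewrite mulg1 -mulrA (posdefV _ pphi) -rmorphM.
under [X in _ + (X + _)]eq_bigr do rewrite big_seq1 invg1 mul1g mulrAC.
rewrite -mulr_suml -mulr_sumr -rmorph_sum /= -/(gpair s phi) -/z.
rewrite invg1 mul1g -normCK.
have n0 : `|z| != 0 by rewrite normr_eq0.
have -> : `|w| = 2 by rewrite normrM normrN normr_nat normf_div normr_id divff ?mulr1.
have -> : w * z^* = - 2 * `|z|.
  by rewrite -mulrA mulrAC -normCK expr2 mulfK.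
have -> : z * w^* = - 2 * `|z|.
  rewrite rmorphM rmorphM /= fmorphV /= rmorphN rmorph_nat.
  rewrite [`|z|^*](CrealP _) ?normr_real //.
  by rewrite mulrCA [z * _]mulrA -normCK expr2 mulfK.
move=> h; have {}h := le_trans h (lerD (lexx _) (lerD (lexx _) hs)).
rewrite -(ler_pM2l (ltr0n C 4)) // -subr_ge0; apply: le_trans h _.
by rewrite le_eqVlt; apply/orP; left; apply/eqP; ring.
Qed.

End Forms.

(** * Riesz products *)

(** A diagonal coefficient of the regular representation: its form is a sum of squared moduli. *)
Lemma posdef_delta1 (R : realType) (G : groupType) :
  posdef (fun y : G => (y == 1%g)%:R : Cx R).
Proof.
move=> n g c; pose F z := \sum_(i < n) c i * (z == g i)%:R.
pose s := undup [seq g i | i <- enum 'I_n].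
have -> : \sum_(i < n) \sum_(j < n) c i * (c j)^* * (((g j)^-1 * g i)%g == 1%g)%:R =
    \sum_(z <- s) F z * (F z)^*.
  transitivity (\sum_(i < n) \sum_(j < n) \sum_(z <- s)
      c i * (c j)^* * ((z == g i)%:R * (z == g j)%:R)).
    apply: eq_bigr => i _; apply: eq_bigr => j _; rewrite -mulr_sumr.
    have gs : g i \in s by rewrite mem_undup map_f // mem_enum.
    rewrite (bigD1_seq (g i)) ?undup_uniq //= eqxx mul1r big1 ?addr0.
      by rewrite mulg_eq1 eqg_inv eq_sym.
    by move=> z /negPf ->; rewrite mul0r.
  under eq_bigr do rewrite exchange_big /=.
  rewrite exchange_big /=; apply: eq_bigr => z _.
  rewrite /F rmorph_sum mulr_suml; apply: eq_bigr => i _.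
  rewrite mulr_sumr; apply: eq_bigr => j _.
  by rewrite rmorphM /= rmorph_nat; ring.
by apply: sumr_ge0 => z _; rewrite -normCK exprn_ge0.
Qed.

(** Used both to bound the test elements above and their pairings below. A new factor adds to the
    error [z k] times the old product minus 1, which is at most twice the old sum in modulus. *)
Lemma prod1D_sub_le (K : numFieldType) (z : nat -> K) k :
  \sum_(j < k) `|z j| <= 1 ->
  `|\prod_(j < k) (1 + z j) - 1 - \sum_(j < k) z j| <= (\sum_(j < k) `|z j|) ^+ 2.
Proof.
elim: k => [|k IH]; first by rewrite !big_ord0 subrr subr0 normr0 expr0n.
rewrite !big_ord_recr /=; set P := \prod_(j < k) _; set U := \sum_(j < k) `|_|.
set S := \sum_(j < k) z _; set v := `|z k| => Uv1.
have U0 : 0 <= U by rewrite sumr_ge0.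
have v0 : 0 <= v by exact: normr_ge0.
have U1 : U <= 1 by rewrite (le_trans _ Uv1) // lerDl.
have SU : `|S| <= U by exact: ler_norm_sum.
have {}IH : `|P - 1 - S| <= U ^+ 2 := IH U1.

have -> : P * (1 + z k) - 1 - (S + z k) = (P - 1 - S) + z k * ((P - 1 - S) + S).
  by ring.
rewrite (le_trans (ler_normD _ _)) // sqrrD -[leRHS]addrA lerD // normrM -/v.
have : `|P - 1 - S + S| <= U + U.
  rewrite (le_trans (ler_normD _ _)) // lerD // (le_trans IH) //.
  by rewrite expr2 ler_piMl.
move=> /(ler_wpM2l v0)/le_trans; apply.
by rewrite mulrDr mulr2n [U * v]mulrC lerDl exprn_ge0.
Qed.

Section RieszProduct.
Variables (R : realType) (G : groupType).
Local Notation C := (Cx R).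
(** [E k] lists the products of powers -1, 0 or 1 of the first [k] elements. The hypotheses [x_out]
    and [xx_out] express dissociateness: [E k] and its translates by [x k] and [(x k)^-1] are
    disjoint, except that the translates agree for an involution. *)
Variables (H : {pred G}) (x : nat -> G) (E : nat -> seq G) (beta : nat -> C).
Hypothesis H_closed : group_closed H.
Hypothesis H_comm : {in H &, forall x y, commute x y}.
Hypothesis xH : forall k, x k \in H.
Hypothesis E0 : E 0%N = [:: 1%g].
Hypothesis ES : forall k, E k.+1 =
  E k ++ [seq (y * x k)%g | y <- E k] ++ [seq (y * (x k)^-1)%g | y <- E k].
Hypothesis x_out : forall k, {in E k &, forall y z, x k != (y^-1 * z)%g}.
Hypothesis xx_out : forall k, (x k * x k = 1)%g \/
  {in E k &, forall y z, (x k * x k != y^-1 * z)%g}.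
Hypothesis beta_gt0 : forall k, 0 < beta k.
Hypothesis beta_le : forall k, beta k <= 2^-1.
Hypothesis beta_cvg : forall e : C, 0 < e ->
  exists k, forall j, (k <= j)%N -> beta j < e.

Lemma E_sub_H k : {subset E k <= H}.
Proof.
have HM := group_closedM H_closed; have HV := group_closedV H_closed.
elim: k => [|k IH] y; rewrite ?E0 ?ES.
  by rewrite inE => /eqP ->; case: H_closed.
rewrite !mem_cat => /or3P[/IH//|/mapP[z /IH zH ->]|/mapP[z /IH zH ->]].
  exact: HM.
by apply: HM => //; exact: HV.
Qed.

Lemma mem_mulx k y : y \in E k -> (y * x k)%g \in E k.+1.
Proof.
by move=> yE; rewrite ES !mem_cat (map_f (fun y => y * x k)%g yE) orbT.
Qed.

Lemma mem_mulVx k y : y \in E k -> (y * (x k)^-1)%g \in E k.+1.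
Proof.
move=> yE; rewrite ES !mem_cat.
by rewrite (map_f (fun y => y * (x k)^-1)%g yE) !orbT.
Qed.

Lemma E_mono j k : (j <= k)%N -> {subset E j <= E k}.
Proof.
elim: k => [|k IH]; first by rewrite leqn0 => /eqP ->.
rewrite leq_eqVlt => /orP[/eqP -> //|/IH h] y /h yE.
by rewrite ES mem_cat yE.
Qed.

Lemma mulx_notin k y : y \in E k -> (y * x k)%g \notin E k.
Proof.
move=> yE; apply/negP => zE.
by have /eqP := x_out yE zE; rewrite mulKg.
Qed.

Lemma mulVx_notin k y : y \in E k -> (y * (x k)^-1)%g \notin E k.
Proof.
move=> yE; apply/negP => zE; have /eqP := x_out zE yE.
by rewrite invgM invgK mulgVK.
Qed.

(* When [x k] is an involution, its coefficient is counted twice. *)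
Definition rcoef k : C := beta k / (if (x k * x k == 1)%g then 2 else 1).

(** Coefficient at [y] of the partial product; each step multiplies by
    [1 + rcoef j * (x_j + x_j^-1)]. *)
Fixpoint rpartial k (y : G) : C :=
  if k is j.+1 then
    rpartial j y + rcoef j * (rpartial j (y * x j)%g + rpartial j (y * (x j)^-1)%g)
  else (y == 1%g)%:R.

Lemma rpartial_out k y : y \notin E k -> rpartial k y = 0.
Proof.
elim: k y => [|k IH] y; first by rewrite E0 inE /= => /negPf ->.
move=> yE /=; rewrite !IH ?addr0 ?mulr0 ?addr0 //; apply: contra yE.
- by move/mem_mulx; rewrite mulgVK.
- by move/mem_mulVx; rewrite mulgK.
- exact: E_mono.
Qed.

Lemma rpartial_stable k y : y \in E k -> rpartial k.+1 y = rpartial k y.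
Proof.
move=> yE /=; rewrite !(rpartial_out (mulx_notin _), rpartial_out (mulVx_notin _)) //.
by rewrite addr0 mulr0 addr0.
Qed.

(** Only the term at [y] survives; for an involution it occurs twice, which the halved [rcoef]
    compensates. *)
Lemma rpartial_mulx k y : y \in E k ->
  rpartial k.+1 (y * x k)%g = beta k * rpartial k y.
Proof.
move=> yE /=; rewrite (rpartial_out (mulx_notin yE)) add0r mulgK /rcoef.
have [xx|xx] := eqVneq (x k * x k)%g 1%g.
  by rewrite -mulgA xx mulg1; field.
rewrite divr1 (@rpartial_out k (y * x k * x k)%g) ?add0r //.
apply/negP => zE; have [/eqP|/(_ _ _ yE zE)/eqP] := xx_out k; first exact/negP.
by rewrite -mulgA mulKg.
Qed.

Lemma rpartial_mulVx k y : y \in E k ->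
  rpartial k.+1 (y * (x k)^-1)%g = beta k * rpartial k y.
Proof.
move=> yE /=; rewrite (rpartial_out (mulVx_notin yE)) add0r mulgVK /rcoef.
have [xx|xx] := eqVneq (x k * x k)%g 1%g.
  by rewrite -mulgA -invgM xx invg1 mulg1; field.
rewrite divr1 (@rpartial_out k (y * (x k)^-1 * (x k)^-1)%g) ?addr0 //.
apply/negP => zE; have [/eqP|/(_ _ _ zE yE)/eqP] := xx_out k; first exact/negP.
by rewrite -[X in X^-1%g]mulgA -invgM [X in (X * y)%g]invgM invgK mulgVK.
Qed.

Lemma rpartial_stable_le j k y : (j <= k)%N -> y \in E j ->
  rpartial k y = rpartial j y.
Proof.
move=> jk yE; elim: k jk => [|k IH]; first by rewrite leqn0 => /eqP ->.
rewrite leq_eqVlt => /orP[/eqP <- //|]; rewrite ltnS => jk.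
by rewrite rpartial_stable ?IH //; exact: E_mono yE.
Qed.

Lemma rcoef_ge0 k : 0 <= rcoef k.
Proof. by rewrite divr_ge0 ?(ltW (beta_gt0 k)) //; case: ifP. Qed.

Lemma rcoef_le k : rcoef k <= 2^-1.
Proof.
apply: le_trans (beta_le k); rewrite /rcoef; case: ifP => _; rewrite ?divr1 //.
by rewrite ler_pdivrMr // ler_peMr ?(ltW (beta_gt0 k)) // ler1n.
Qed.

(** The factor [1 + b (x + x^-1)] equals [(1 - 2 b) + b (1 + x)^* (1 + x)], with nonnegative
    coefficients since [b <= 1/2]. *)
Lemma rpartial_posdef k : posdef (rpartial k).
Proof.
have HM := group_closedM H_closed; have HV := group_closedV H_closed.
elim: k => [|k IH].
  exact: posdef_delta1.
have outH y : y \notin H -> rpartial k y = 0.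
  by move=> yH; apply: rpartial_out; apply: contra yH; exact: E_sub_H.
pose d := [:: ((1 : C), 1%g); ((1 : C), x k)].
pose b := rcoef k.
pose psi y : C := \sum_(r <- d) \sum_(r' <- d)
  r.1 * (r'.1)^* * rpartial k ((r'.2)^-1 * y * r.2)%g.
have -> : rpartial k.+1 = (1 - 2 * b) *: rpartial k + b *: psi.
  apply/funext => y.
  rewrite -[RHS]/((1 - 2 * b) * rpartial k y + b * psi y).
  rewrite /psi /d !big_cons !big_nil /= !addr0.
  rewrite rmorph1 !mul1r invg1 !mul1g !mulg1 -/b.
  (* On [H] commutation identifies the two sides; off [H] every term vanishes. *)
  have [yH|yH] := boolP (y \in H).
    have -> : ((x k)^-1 * y = y * (x k)^-1)%g.
      exact: H_comm (HV _ (xH k)) yH.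
    by rewrite mulgVK; ring.
  have mulH u z : u \notin H -> z \in H -> (u * z)%g \notin H.
    by move=> uH zH; apply: contra uH => uz; rewrite -(mulgK z u) HM // HV.
  have mulH' u z : u \notin H -> z \in H -> (z * u)%g \notin H.
    by move=> uH zH; apply: contra uH => uz; rewrite -(mulKg z u) HM // HV.
  have xV := HV _ (xH k).
  by rewrite !outH ?(mulH _ _ _ (xH k)) ?(mulH _ _ _ xV) ?(mulH' _ _ _ xV) //; ring.
apply: posdefD.
  apply: posdefZ => //; rewrite subr_ge0 -ler_pdivlMl // mulr1; exact: rcoef_le.
by apply: posdefZ; [exact: rcoef_ge0|exact: posdef_act].
Qed.

(** The partial products are constant at [y] once [y] is in [E k], so any such [k] gives the value
    of the infinite product. *)
Definition riesz (y : G) : C :=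
  if pselect (exists k, y \in E k) is left h then rpartial (projT1 (cid h)) y else 0.

Lemma rieszE k y : y \in E k -> riesz y = rpartial k y.
Proof.
move=> yE; rewrite /riesz; case: pselect => [h|[]]; last by exists k.
case: (cid h) => j yj /=; have [jk|/ltnW kj] := leqP j k.
  by rewrite (rpartial_stable_le jk).
by rewrite (rpartial_stable_le kj).
Qed.

Lemma riesz_out y : (forall k, y \notin E k) -> riesz y = 0.
Proof.
move=> yE; rewrite /riesz; case: pselect => // h; exfalso.
by case: h => k; apply/negP.
Qed.

(** Finitely many points see only finitely many factors; this carries positive definiteness to the
    limit. *)
Lemma riesz_rpartial (s : seq G) : exists k, {in s, riesz =1 rpartial k}.
Proof.
suff [k kP] : exists k, forall j, (k <= j)%N -> {in s, riesz =1 rpartial j}.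
  by exists k; exact: kP.
elim: s => [|y s [k kP]]; first by exists 0%N.
have [i iP] : exists i, forall j, (i <= j)%N -> riesz y = rpartial j y.
  have [[i yE]|yE] := pselect (exists i, y \in E i).
    by exists i => j ij; apply: rieszE; exact: E_mono yE.
  have {}yE j : y \notin E j by apply/negP => yj; apply: yE; exists j.
  by exists 0%N => j _; rewrite riesz_out // rpartial_out.
exists (maxn i k) => j; rewrite geq_max => /andP[ij kj] z.
by rewrite inE => /predU1P[->|]; [exact: iP|exact: kP].
Qed.

Lemma riesz_posdef : posdef riesz.
Proof.
move=> n g c.
have [k kP] := riesz_rpartial [seq ((g j)^-1 * g i)%g | i <- enum 'I_n, j <- enum 'I_n].
have := rpartial_posdef k g c; congr (0 <= _).
apply: eq_bigr => i _; apply: eq_bigr => j _; rewrite kP //.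
by apply/allpairsP; exists (i, j); rewrite !mem_enum.
Qed.

Lemma riesz1 : riesz 1%g = 1.
Proof. by rewrite (@rieszE 0) ?E0 ?inE //= eqxx. Qed.

Lemma riesz_mulx k y : y \in E k -> riesz (y * x k)%g = beta k * riesz y.
Proof.
by move=> yE; rewrite (rieszE yE) (rieszE (mem_mulx yE)) rpartial_mulx.
Qed.

Lemma riesz_mulVx k y : y \in E k -> riesz (y * (x k)^-1)%g = beta k * riesz y.
Proof.
by move=> yE; rewrite (rieszE yE) (rieszE (mem_mulVx yE)) rpartial_mulVx.
Qed.

Lemma riesz_le1 y : `|riesz y| <= 1.
Proof.
have [[k]|yE] := pselect (exists k, y \in E k); last first.
  by rewrite riesz_out ?normr0 // => k; apply/negP => yk; apply: yE; exists k.
have b0 j := ltW (beta_gt0 j).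
have b1 j : beta j <= 1 by rewrite (le_trans (beta_le j)) // invf_le1 ?ler1n.
elim: k y => [|k IH] y.
  by rewrite E0 inE => /eqP ->; rewrite riesz1 normr1.
rewrite ES !mem_cat => /or3P[/IH//|/mapP[z zE ->]|/mapP[z zE ->]].
  by rewrite riesz_mulx // normrM ger0_norm // mulr_ile1 // IH.
by rewrite riesz_mulVx // normrM ger0_norm // mulr_ile1 // IH.
Qed.

(** Outside [E k], [y] enters at a step [j >= k] through [x j] or its inverse, at the cost of a
    factor [beta j]. Large [k] gives vanishing at infinity, [k = 0] the bound 1/2. *)
Lemma riesz_small k y : y \notin E k -> riesz y != 0 ->
  exists2 j, (k <= j)%N & `|riesz y| <= beta j.
Proof.
move=> yk ry.
have {ry}[m yE] : exists m, y \in E m.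
  apply: contrapT => yE; move/eqP: ry; apply; apply: riesz_out => m.
  by apply/negP => ym; apply: yE; exists m.
elim: m yE => [|m IH] yE; first by rewrite (E_mono (leq0n k) yE) in yk.
have km : (k <= m)%N.
  rewrite leqNgt; apply: contra yk => mk; exact: E_mono yE.
have b0 j := ltW (beta_gt0 j).
move: yE; rewrite ES !mem_cat => /or3P[/IH//|/mapP[z zE ->]|/mapP[z zE ->]].
  by exists m => //; rewrite riesz_mulx // normrM ger0_norm // ler_piMr // riesz_le1.
by exists m => //; rewrite riesz_mulVx // normrM ger0_norm // ler_piMr // riesz_le1.
Qed.

Lemma riesz_vanishes : vanishes_at_infinity riesz.
Proof.
move=> e e0; have [k kP] := beta_cvg e0.
apply: (@sub_finite_set _ _ [set` E k]) => // y /= ey.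
apply: contraPT ey => yk; have [->|ry] := eqVneq (riesz y) 0.
  by rewrite normr0 => /(lt_le_trans e0); rewrite ltxx.
have [j kj /le_lt_trans/(_ (kP j kj)) h] := riesz_small yk ry.
by move=> /(lt_le_trans h); rewrite ltxx.
Qed.

Lemma riesz_le_half y : y != 1%g -> `|riesz y| <= 2^-1.
Proof.
move=> y1; have [->|ry] := eqVneq (riesz y) 0; first by rewrite normr0 invr_ge0.
have y0 : y \notin E 0 by rewrite E0 inE.
by have [j _ h] := riesz_small y0 ry; exact: le_trans h (beta_le j).
Qed.

(** * Test elements of the group algebra *)

Section TestElement.
Variable t : nat -> C.
Hypothesis t_real : forall j, t j \is Num.real.

Fixpoint rtest k : seq (C * G) :=
  if k is j.+1 then
    gact [:: (1, 1%g); ('i * t j, x j); ('i * t j, (x j)^-1%g)] (rtest j)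
  else [:: (1, 1%g)].

Lemma rtest_E k p : p \in rtest k -> p.2 \in E k.
Proof.
elim: k p => [|k IH] p /=; first by rewrite E0 !inE => /eqP ->.
move=> /allpairsP[[q r] /= [/IH qE]]; rewrite !inE => rd ->.
case/or3P: rd => /eqP -> /=.
- by rewrite mulg1; exact: E_mono qE.
- exact: mem_mulx.
- exact: mem_mulVx.
Qed.

(** Applied to powers of [riesz], with powers of [beta] as [gam], and to the delta function at 1,
    with [gam] zero. *)
Lemma gpair_rtest (u : G -> C) (gam : nat -> C) k :
    (forall j y, y \in E j -> u (y * x j)%g = gam j * u y) ->
    (forall j y, y \in E j -> u (y * (x j)^-1)%g = gam j * u y) ->
  gpair (rtest k) u = \prod_(j < k) (1 + 2 * ('i * t j * gam j)) * u 1%g.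
Proof.
move=> hx hVx; elim: k => [|k IH].
  by rewrite /gpair big_seq1 big_ord0.
rewrite big_ord_recr mulrAC -IH /= /gpair big_allpairs_dep /= mulr_suml.
apply: eq_big_seq => p /rtest_E pE.
rewrite !big_cons big_nil /= mulg1 hx // hVx //; ring.
Qed.

Lemma gform_shift (phi : G -> C) (s : seq (C * G)) (a b : G) : a \in H -> b \in H ->
    (forall p, p \in s -> p.2 \in H) ->
  gform (fun y => phi (a^-1 * y * b)%g) s s =
  gform (fun y => phi (y * (a^-1 * b))%g) s s.
Proof.
have HM := group_closedM H_closed; have HV := group_closedV H_closed.
move=> aH bH sH; apply: eq_big_seq => p ps; apply: eq_big_seq => q qs.
congr (_ * phi _); rewrite [RHS]mulgA; congr (_ * _)%g.
by apply: H_comm; [exact: HV|apply: HM; [apply: HV|]; exact: sH].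
Qed.

(** The imaginary coefficient cancels first-order terms: [1 + i t (x + x^-1)] has squared modulus
    [1 + t^2 (x + x^-1)^2]. This falls short of [1 + 4 t^2] by the squared modulus of
    [t (x - x^-1)], the element [d] of the proof. *)
Lemma gform_rtest_le (phi : G -> C) k : posdef phi ->
  gform phi (rtest k) (rtest k) <= \prod_(j < k) (1 + 4 * t j ^+ 2) * phi 1%g.
Proof.
have [H1 _] := H_closed.
have HM := group_closedM H_closed; have HV := group_closedV H_closed.
move=> pphi; elim: k => [|k IH].
  by rewrite /gform !big_seq1 big_ord0 /= rmorph1 invg1 !mul1g !mul1r.
rewrite big_ord_recr mulrAC /=; set s := rtest k; set c := t k.
have c2 : 0 <= 1 + 4 * c ^+ 2.
  by rewrite addr_ge0 // mulr_ge0 // real_exprn_even_ge0 ?t_real.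
apply: le_trans (ler_wpM2r c2 IH); rewrite -subr_ge0.
have sH p : p \in s -> p.2 \in H by move=> /rtest_E; exact: E_sub_H.
pose d := [:: (c, x k); (- c, (x k)^-1%g)].
have := posdef_gform (gact d s) pphi; congr (0 <= _).
rewrite !gform_act !big_cons !big_nil /= !gform_shift ?HV //.
rewrite !invg1 !invgK !mulg1 !mul1g mulgV mulVg.
have cc : c^* = c by apply/CrealP/t_real.
rewrite !rmorphM rmorphN /= rmorph1 conjCi cc.
have -> : gform (fun y => phi (y * 1)%g) s s = gform phi s s.
  by congr (gform _ s s); apply/funext => y; rewrite mulg1.
rewrite -/s.
move: (gform phi s s) (gform _ s s) (gform _ s s) (gform _ s s) (gform _ s s).
move=> a1 a2 a3 a4 a5.
have ii : 'i * 'i = -1 :> C by rewrite -expr2 sqrCi.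
by ring: ii.
Qed.

End TestElement.

Lemma riesz_test n k : 1 <= \sum_(j < k) beta j ^+ (2 * n.+1) ->
  exists s : seq (C * G), (forall phi, posdef phi -> `|gpair s phi| <= 2 * phi 1%g) /\
    4^-1 <= `|gpair s (fun y => (riesz y - (y == 1%g)%:R) ^+ n.+1)|.
Proof.
set S := \sum_(j < k) _ => S1; have S0 := lt_le_trans ltr01 S1.
(* This [a] makes the first-order part of the pairing equal to [i / 2], and the sum of the
   [4 * t j ^+ 2] equal to [a], hence at most 1/4. *)
pose a : C := (4 * S)^-1.
have a0 : 0 < a by rewrite invr_gt0 mulr_gt0.
have aS : 4 * a * S = 1 by rewrite /a; field; rewrite gt_eqF.
have aS2 : 2^-1 = 2 * a * S.
  have -> : 2 * a * S = 2^-1 * (4 * a * S) by field.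
  by rewrite aS mulr1.
have a1 : a <= 4^-1 by rewrite lef_pV2 ?posrE ?mulr_gt0 // ler_peMr.
pose t j := a * beta j ^+ n.+1.
have t_real j : t j \is Num.real.
  by rewrite ger0_real // mulr_ge0 ?exprn_ge0 ?ltW.
have betaE j : beta j ^+ (2 * n.+1) = beta j ^+ n.+1 * beta j ^+ n.+1.
  by rewrite mul2n -addnn exprD.
exists (rtest t k); split=> [phi pphi|].
  apply: gpair_le => //; apply: le_trans (gform_rtest_le t_real k pphi) _.
  apply: ler_wpM2r; first exact: posdef_ge0.
  pose w j := 4 * t j ^+ 2.
  have w0 j : 0 <= w j by rewrite mulr_ge0 // real_exprn_even_ge0.
  have wS : \sum_(j < k) w j = a.
    have -> : a = 4 * a * a * S by rewrite mulrAC aS mul1r.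
    by rewrite /S mulr_sumr; apply: eq_bigr => j _; rewrite /w /t betaE; ring.
  have wE : \sum_(j < k) `|w j| = a.
    by rewrite -wS; apply: eq_bigr => j _; rewrite ger0_norm.
  have := @prod1D_sub_le C w k; rewrite wE wS.
  have a41 : a <= 1 by rewrite (le_trans a1) // invf_le1 ?ler1n.
  move=> /(_ a41); set P := \prod_(j < k) _ => PE.
  have P0 : 0 <= P by apply: prodr_ge0 => j _; rewrite addr_ge0.
  have Pr : P - 1 - a \is Num.real by rewrite !rpredB // ger0_real // ltW.
  have := le_trans (real_ler_norm Pr) PE.
  rewrite -addrA -opprD lerBlDr => /le_trans; apply.
  have -> : 4 = 1 + (1 + 2) :> C by ring.
  by rewrite lerD ?lerD ?exprn_ile1 ?(ltW a0) ?(le_trans a41) ?ler1n.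
(* At 1 both sides vanish, as [riesz] is 1 there and the exponent is positive; elsewhere the delta
   term is 0. *)
have gpairE : gpair (rtest t k) (fun y => (riesz y - (y == 1%g)%:R) ^+ n.+1) =
    gpair (rtest t k) (fun y => riesz y ^+ n.+1) -
    gpair (rtest t k) (fun y => (y == 1%g)%:R).
  rewrite /gpair -sumrB; apply: eq_bigr => p _; rewrite -mulrBr; congr (_ * _).
  have [->|_] := eqVneq p.2 1%g; last by rewrite !subr0.
  by rewrite riesz1 expr1n subrr expr0n.
rewrite gpairE (gpair_rtest _ (gam := fun j => beta j ^+ n.+1)); first last.
- by move=> j y yE; rewrite riesz_mulVx // exprMn.
- by move=> j y yE; rewrite riesz_mulx // exprMn.
rewrite (gpair_rtest _ (gam := fun=> 0)); first last.
- move=> j y yE; rewrite mul0r; case: eqP => // y1; have := mulVx_notin yE.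
  by rewrite y1 (E_mono (leq0n j)) // E0 inE.
- move=> j y yE; rewrite mul0r; case: eqP => // y1; have := mulx_notin yE.
  by rewrite y1 (E_mono (leq0n j)) // E0 inE.
rewrite riesz1 expr1n !mulr1 eqxx [X in _ - X * _]big1 ?mulr1; last first.
  by move=> j _; rewrite !mulr0 addr0.
pose z j := 2 * ('i * t j * beta j ^+ n.+1).
have zS : \sum_(j < k) z j = 'i * 2^-1.
  rewrite aS2 /S !mulr_sumr; apply: eq_bigr => j _; rewrite /z /t betaE; ring.
have zE : \sum_(j < k) `|z j| = 2^-1.
  rewrite aS2 /S !mulr_sumr; apply: eq_bigr => j _.
  rewrite /z /t betaE !normrM normCi normr_nat !ger0_norm ?exprn_ge0 ?ltW //.
  by ring.
have := @prod1D_sub_le C z k; rewrite zE zS invf_le1 ?ler1n // => /(_ isT).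
set P := \prod_(j < k) _ => PE.
(* The linear part has modulus 1/2 and the error is at most 1/4. *)
have := ler_distD (P - 1) ('i * 2^-1) 0.
rewrite !subr0 normrM normCi mul1r normfV normr_nat distrC => h.
have {}h := le_trans h (lerD PE (lexx _)).
rewrite -lerBlDl in h; apply: le_trans h.
by rewrite le_eqVlt; apply/orP; left; apply/eqP; field.
Qed.

End RieszProduct.

(** * Choice of the coefficients and of the dissociate sequence *)

Lemma exists_slow_sequence (R : realType) : exists beta : nat -> Cx R,
  [/\ forall k, 0 < beta k, forall k, beta k <= 2^-1,
      forall e, 0 < e -> exists k, forall j, (k <= j)%N -> beta j < e &
      forall n, exists k, 1 <= \sum_(j < k) beta j ^+ n].
Proof.
(* [L j] will be the least [l] with [j < big l], and [beta j] the inverse of [L j + 2]. For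
   [j < big n] this is at least [1 / (n + 2)], so these [(n + 2) ^ n] terms have n-th powers summing
   to at least 1. *)
pose big k := ((k + 2) ^ k)%N.
have ex j : exists k, (j < big k)%N.
  exists j; case: j => // j.
  by rewrite (leq_trans (ltn_expl _ (ltnSn 1))) // leq_exp2r ?addn2.
have big_mono k m : (k <= m)%N -> (big k <= big m)%N.
  case: k => [|k] km; first by rewrite expn_gt0 addn2.
  by rewrite (@leq_trans ((m + 2) ^ k.+1)) ?leq_exp2r ?leq_add2r ?leq_pexp2l ?addn2.
have exL j : exists l, (j < big l)%N /\ forall k, (j < big k)%N -> (l <= k)%N.
  by case: (ex_minnP (ex j)) => l; exists l.
have [L LP] := choice exL.
exists (fun j => (L j + 2)%:R^-1); split=> [k|k|e e0|n].
- by rewrite invr_gt0 ltr0n addn2.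
- by rewrite lef_pV2 ?posrE ?ltr0n ?addn2 // ler_nat.
- have [r r0 ->] : exists2 r : R, 0 < r & e = r%:C%C.
    by exists (complex.Re e); rewrite ?RRe_real ?gtr0_real // -ltcR RRe_real ?gtr0_real.
  have /archi_boundP : 0 <= r^-1 by rewrite invr_ge0 ltW.
  set m := Num.bound _ => rm; exists (big m) => j mj.
  have mL : (m < L j)%N.
    rewrite ltnNge; apply/negP => /big_mono Lm.
    have [jL _] := LP j; have := leq_trans jL (leq_trans Lm mj).
    by rewrite ltnn.
  have -> : (L j + 2)%:R^-1 = ((L j + 2)%:R^-1)%:C%C :> Cx R.
    by rewrite fmorphV rmorph_nat.
  rewrite ltcR invf_plt ?posrE ?ltr0n ?addn2 //; apply: lt_trans rm _.
  by rewrite ltr_nat (ltn_trans mL) // ltnS leqnSn.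
- exists (big n).
  have n0 : (n + 2)%:R ^+ n != 0 :> Cx R by rewrite expf_neq0 // pnatr_eq0 addn2.
  apply: (@le_trans _ _ (\sum_(j < big n) (n + 2)%:R^-1 ^+ n)).
    by rewrite sumr_const card_ord exprVn -[leRHS]mulr_natr /big natrX mulVf.
  apply: ler_sum => j _; rewrite lerXn2r ?nnegrE ?invr_ge0 ?ler0n //.
  rewrite lef_pV2 ?posrE ?ltr0n ?addn2 // ler_nat !ltnS.
  by have [_] := LP j; apply.
Qed.

(** Otherwise every [u] in [H] outside the finite set [Q] has [u * u] in [Q] and different from 1.
    Two such elements with the same square differ by an element of square 1, which must lie in [Q];
    so each square has finitely many such roots and [H] is finite. *)
Lemma exists_riesz_index (G : groupType) (H : {pred G}) : group_closed H ->
    {in H &, forall x y, commute x y} -> infinite_set [set` H] ->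
  forall E : seq G, exists x, [/\ x \in H, {in E &, forall y z, x != (y^-1 * z)%g} &
    (x * x = 1)%g \/ {in E &, forall y z, (x * x != y^-1 * z)%g}].
Proof.
move=> H_closed H_comm H_inf E.
have HM := group_closedM H_closed; have HV := group_closedV H_closed.
pose Q := [seq (y^-1 * z)%g | y <- E, z <- E].
have QP u : u \notin Q -> {in E &, forall y z, u != (y^-1 * z)%g}.
  move=> uQ y z yE zE; apply: contra uQ => /eqP ->.
  by apply/allpairsP; exists (y, z).
apply: contrapT => none.
have sqQ u : u \in H -> u \notin Q -> (u * u != 1)%g /\ (u * u)%g \in Q.
  move=> uH uQ; split.
    apply/eqP => uu; apply: none; exists u.
    by split; [|exact: QP|left].
  apply/negPn/negP => uu; apply: none; exists u.
  by split; [|exact: QP|right; exact: QP].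
pose T q := [set u | [/\ u \in H, u \notin Q & (u * u)%g = q]].
have finT q : finite_set (T q).
  have [->|/set0P[v [vH vQ vq]]] := eqVneq (T q) set0; first exact: finite_set0.
  apply: (@sub_finite_set _ _ ((fun w => w * v)%g @` [set` Q])); last first.
    exact: finite_image.
  move=> u [uH uQ uq]; exists (u * v^-1)%g; last by rewrite mulgVK.
  apply/negPn/negP => wQ; have wH : (u * v^-1)%g \in H by rewrite HM // HV.
  have [/eqP []] := sqQ _ wH wQ.
  have cuv : (u * v^-1 = v^-1 * u)%g by apply: H_comm; rewrite ?HV.
  have -> : (u * v^-1 * (u * v^-1) = u * u * (v * v)^-1)%g.
    by rewrite invgM !mulgA -[(u * v^-1 * u)%g]mulgA -cuv !mulgA.
  by rewrite uq vq mulgV.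
apply: H_inf; apply: (@sub_finite_set _ _ ([set` Q] `|` \bigcup_(q in [set` Q]) T q)).
  move=> u /= uH; have [uQ|uQ] := boolP (u \in Q); first by left.
  by right; exists (u * u)%g => //=; have [] := sqQ u uH uQ.
by rewrite finite_setU; split=> //; exact: bigcup_finite.
Qed.

(** * The norm of B(G) *)

Section FourierStieltjesNorm.
Variables (R : realType) (G : groupType).
Local Notation C := (Cx R).

(** [phi i 1] is the norm of the positive definite [phi i]. Arbitrary finite index types let sums
    and products of decompositions be indexed by [I + J] and [I * J]. *)
Definition fs_bound (f : fsalg R G) (b : R) : Prop :=
  exists (I : finType) (a : I -> C) (phi : I -> G -> C),
    [/\ forall i, posdef (phi i), fsalg_fun f = \sum_i a i *: phi i &
        \sum_i `|a i| * phi i 1%g <= b%:C%C].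

Lemma fs_bound_norm : norm_bound fs_bound.
Proof.
split.
- move=> f b [I [a [phi [pphi _ h]]]]; rewrite -ler0c; apply: le_trans h.
  by apply: sumr_ge0 => i _; rewrite mulr_ge0 ?(posdef_ge0 (pphi i)).
- move=> f; have /set_mem [n [a [phi [pphi fE]]]] := valP f.
  have h : 0 <= \sum_i `|a i| * phi i 1%g.
    by apply: sumr_ge0 => i _; rewrite mulr_ge0 ?(posdef_ge0 (pphi i)).
  exists (complex.Re (\sum_i `|a i| * phi i 1%g)), 'I_n, a, phi; split=> //.
  by rewrite RRe_real // ger0_real.
- move=> f b c [I [a [phi [pphi fE h]]]] bc; exists I, a, phi; split=> //.
  by rewrite (le_trans h) // lecR.
- move=> f1 f2 b1 b2 [I [a [phi [pphi fE h]]]] [J [c [psi [ppsi gE h']]]].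
  exists (I + J)%type, (fun k => match k with inl i => a i | inr j => c j end),
    (fun k => match k with inl i => phi i | inr j => psi j end).
  split=> [[]//||]; rewrite big_sumType /=.
    by rewrite -fE -gE.
  by rewrite rmorphD lerD.
- move=> z f b [I [a [phi [pphi fE h]]]].
  exists I, (fun i => z * a i), phi; split=> //.
    transitivity (z *: fsalg_fun f) => //.
    by rewrite fE scaler_sumr; apply: eq_bigr => i _; rewrite scalerA.
  rewrite rmorphM /=; apply: le_trans (ler_wpM2l (normr_ge0 z) h).
  by rewrite mulr_sumr; apply: ler_sum => i _; rewrite normrM mulrA.
- move=> f1 f2 b1 b2 [I [a [phi [pphi fE h]]]] [J [c [psi [ppsi gE h']]]].
  exists (I * J)%type, (fun k => a k.1 * c k.2), (fun k => phi k.1 * psi k.2).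
  split=> [k||]; first exact: posdefM.
    transitivity (fsalg_fun f1 * fsalg_fun f2) => //.
    rewrite fE gE mulr_suml -(pair_bigA _ (fun i j => (a i * c j) *: (phi i * psi j))) /=.
    apply: eq_bigr => i _; rewrite mulr_sumr; apply: eq_bigr => j _.
    by apply/funext => y; exact: mulrACA.
  rewrite rmorphM; apply: le_trans (ler_pM _ _ h h'); last 2 first.
  + by apply: sumr_ge0 => i _; rewrite mulr_ge0 ?(posdef_ge0 (pphi i)).
  + by apply: sumr_ge0 => j _; rewrite mulr_ge0 ?(posdef_ge0 (ppsi j)).
  rewrite mulr_suml -(pair_bigA _ (fun i j => `|a i * c j| * (phi i * psi j) 1%g)) /=.
  apply: ler_sum => i _; rewrite mulr_sumr; apply: ler_sum => j _.
  by rewrite normrM mulrACA.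
Qed.

(** Duality: it turns a lower bound on a pairing into one on the norm of [f]. *)
Lemma fs_bound_gpair (f : fsalg R G) b (s : seq (C * G)) (m : C) : fs_bound f b ->
    (forall phi, posdef phi -> `|gpair s phi| <= m * phi 1%g) -> 0 <= m ->
  `|gpair s f| <= m * b%:C%C.
Proof.
move=> [I [a [phi [pphi fE h]]]] hs m0.
apply: le_trans (ler_wpM2l m0 h); rewrite /gpair fE.
have -> : \sum_(p <- s) p.1 * (\sum_i a i *: phi i) p.2 = \sum_i a i * gpair s (phi i).
  rewrite /gpair; under [RHS]eq_bigr do rewrite mulr_sumr.
  rewrite exchange_big /=; apply: eq_bigr => p _.
  rewrite fct_sumE mulr_sumr; apply: eq_bigr => i _; exact: mulrCA.
rewrite (le_trans (ler_norm_sum _ _ _)) // mulr_sumr.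
by apply: ler_sum => i _; rewrite normrM mulrCA ler_wpM2l // hs.
Qed.

End FourierStieltjesNorm.

(** * The unnatural element and its extra spectral value *)

Lemma fsalg_expE (R : realType) (G : groupType) (f : fsalg R G) n y :
  (f ^+ n : fsalg R G) y = f y ^+ n.
Proof. by elim: n => [//|n IH]; rewrite !exprS -IH. Qed.

(** Subtracting the delta function removes the value 1 of the Riesz product at the identity.
    Pairings of modulus at least 1/4 with test elements of size at most 2 give the constant
    [8^-1]. *)
Lemma exists_unnatural_element (R : realType) (G : groupType) :
    has_infinite_abelian_subgroup G ->
  exists g : fsalg0 R G, (forall y, `|g y| <= 2^-1) /\
    forall n b, fs_bound ((g : fsalg R G) ^+ n.+1) b -> 8^-1 <= b.
Proof.
move=> [H [H_closed H_comm H_inf]].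
have [beta [beta_gt0 beta_le beta_cvg beta_div]] := exists_slow_sequence R.
have [pick pickP] := choice (exists_riesz_index H_closed H_comm H_inf).
pose next E := E ++ [seq (y * pick E)%g | y <- E] ++
  [seq (y * (pick E)^-1)%g | y <- E].
pose E k := iter k next [:: 1%g].
pose x k := pick (E k).
have xH k : x k \in H by have [] := pickP (E k).
have x_out k : {in E k &, forall y z, x k != (y^-1 * z)%g}.
  by have [] := pickP (E k).
have xx_out k : (x k * x k = 1)%g \/ {in E k &, forall y z, (x k * x k != y^-1 * z)%g}.
  by have [] := pickP (E k).
have E0 : E 0%N = [:: 1%g] by [].
have ES k : E k.+1 = E k ++ [seq (y * x k)%g | y <- E k] ++
  [seq (y * (x k)^-1)%g | y <- E k] by [].
pose f := riesz x E beta.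
pose delta (y : G) : Cx R := (y == 1%g)%:R.
pose gf : G -> Cx R := f + (-1) *: delta.
have gfE y : gf y = f y - delta y.
  by rewrite -[LHS]/(f y + (-1) * delta y) mulN1r.
have f1 : f 1%g = 1 by exact: riesz1.
have gB : gf \in fourier_stieltjes R G.
  rewrite inE; apply: fourier_stieltjesD.
    by apply: fourier_stieltjes_posdef; exact: (@riesz_posdef _ _ H).
  apply: fourier_stieltjesZ; apply: fourier_stieltjes_posdef.
  exact: posdef_delta1.
have delta0 : vanishes_at_infinity delta.
  move=> e e0; apply: (@sub_finite_set _ _ [set` [:: 1%g]]) => // y /=.
  apply: contraPT; rewrite inE /delta => /negPf ->.
  by rewrite normr0 => /(lt_le_trans e0); rewrite ltxx.
have gf0 : vanishes_at_infinity gf.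
  apply: vanishes_at_infinityD; last exact: vanishes_at_infinityZ.
  exact: riesz_vanishes.
pose g1 : fsalg R G := exist (fun f => f \in fourier_stieltjes R G) gf gB.
have g1P : g1 \in fsalg0_pred (G:=G) by exact/fsalg0P.
exists (exist (fun f => f \in fsalg0_pred (G:=G)) g1 g1P); split=> [y|n b].
  rewrite -[X in `|X|]/(gf y) gfE /delta.
  have [->|y1] := eqVneq y 1%g; first by rewrite f1 subrr normr0 invr_ge0.
  by rewrite subr0; exact: riesz_le_half.
move=> hb; have [k Sk] := beta_div (2 * n.+1)%N.
have [s [s_le s_ge]] := @riesz_test _ _ H x E beta H_closed H_comm xH E0 ES x_out
  xx_out beta_gt0 n k Sk.
have := fs_bound_gpair hb s_le (ler0n _ _).
have -> : gpair s ((g1 : fsalg R G) ^+ n.+1 : fsalg R G) =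
    gpair s (fun y => (riesz x E beta y - (y == 1%g)%:R) ^+ n.+1).
  by congr gpair; apply/funext => y; rewrite fsalg_expE -gfE.
move=> /(le_trans s_ge) h.
have : (8^-1 : R)%:C%C <= b%:C%C :> Cx R; last by rewrite lecR.
rewrite fmorphV rmorph_nat -(ler_pM2l (ltr0n (Cx R) 2)).
by apply: le_trans h; rewrite le_eqVlt; apply/orP; left; apply/eqP; field.
Qed.

Theorem theorem2p3 (R : realType) (G : groupType)
    (hG : has_infinite_abelian_subgroup G) :
  (exists f : fsalg0 R G, ~ natural_spectrum f) /\
  ~ dense (range (@point_eval R G)).
Proof.
have [g [g_le g_ge]] := exists_unnatural_element R hG.
have [|chi [chi_lin chiM chi_g]] := norm_bound_character (@fs_bound_norm R G) _ g_ge.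
  by rewrite invr_gt0.
pose l := chi (fsalg0_val g).
have l1 : 1 <= `|l| by rewrite -[1]/(1%:C%C) lecR.
have far y : ~ ball l 2^-1 (g y).
  rewrite -ball_normE /= => lgy; suff : 1 < 1 :> Cx R by rewrite ltxx.
  rewrite (le_lt_trans l1) // -(subrK (g y) l) (le_lt_trans (ler_normD _ _)) //.
  by rewrite [ltRHS]splitr div1r ltr_leD.
have l0 : l != 0 by rewrite -normr_gt0 (lt_le_trans ltr01 l1).
(* Since [chi] does not vanish at [g], it is unital; an inverse of [g - l%:A] would then give 0 =
   1. *)
have chi1 : chi 1 = 1.
  by apply: (mulIf l0); rewrite mul1r -chiM mul1r.
split.
  exists g => spec_g.
  have : closure (range g) l.
    rewrite -spec_g => -[b [bg _]].
    have chiB f h : chi (f - h) = chi f - chi h.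
      by rewrite addrC -scaleN1r chi_lin mulN1r addrC.
    have chiZ z f : chi (z *: f) = z * chi f.
      have := chi_lin z f 0; rewrite addr0 => ->.
      by rewrite -(subrr 0) chiB subrr addr0.
    have := congr1 chi bg; rewrite chiM chiB chiZ chi1 mulr1 subrr mulr0.
    by move/eqP; rewrite eq_sym oner_eq0.
  move=> /(_ _ (nbhsx_ballx l 2^-1 _)) [|_ [[y _ <-]]]; last exact: far.
  by rewrite invr_gt0.
have chi0 : (fun f : fsalg0 R G => chi (fsalg0_val f)) \in gelfand_fsalg0 (G:=G).
  rewrite inE; split=> [z f h|f h|]; [exact: chi_lin|exact: chiM|by exists g].
(* This weak* neighbourhood of the restriction of [chi] contains no evaluation, by [far]. *)
move=> /(_ ((fun psi : gelfand_fsalg0 (G:=G) => set_val psi g) @^-1` ball l 2^-1)).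
case.
- exists (exist (fun psi => psi \in gelfand_fsalg0 (G:=G)) _ chi0).
  by apply: ballxx; rewrite invr_gt0.
- apply: open_comp; last by apply: ball_open; rewrite invr_gt0.
  move=> psi _; apply: (@continuous_comp _ _ _ set_val (fun f : {ptws fsalg0 R G -> Cx R} => f g)).
    exact: initial_continuous.
  exact: proj_continuous.
- by move=> psi [/= lg [y _ yE]]; rewrite -yE in lg; exact: far lg.
Qed.
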